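(* Let $E$ be a finite set, let $\mathscr{P}$ be a family of subsets of $E$, ordered by inclusion, all of whose closed intervals are graded, and let $K<L$ be elements of $\mathscr{P}$. If the interval $[K,L]_{\mathscr{P}}=\{F\in\mathscr{P}:K\subseteq F\subseteq L\}$ is the lattice of flats of a matroid (on ground set $L$), then the polynomial $\mathrm{pol}_K^L$, viewed as a polynomial on $\mathscr{E}_K^L$ (i.e. in the variables $t_S$, $K\subset S\subset L$), is $\mathscr{C}_K^L$-Lorentzian.
   Context: Throughout $\subset$ denotes strict inclusion. Lattice of flats: a family $\mathscr{L}$ of subsets of a finite set $X$, ordered by inclusion, is the lattice of flats of a matroid on $X$ if and only if (F1) $X\in\mathscr{L}$; (F2) $F,G\in\mathscr{L}$ implies $F\cap G\in\mathscr{L}$; (F3) for each $H\in\mathscr{L}$ the sets $A\setminus H$, where $A$ ranges over the elements of $\mathscr{L}$ covering $H$, partition $X\setminus H$. Here $X=L$, so $K$ is the set of loops. Spaces and cones: for finite sets $K\subset L$ let $\mathscr{E}_K^L=\{(y_S)_{K\subset S\subset L}:y_S\in\mathbb{R}\}\cong\mathbb{R}^{2^{|L\setminus K|}-2}$, indexed by all sets $S$ strictly between $K$ and $L$. $\mathscr{C}_K^L$ is the open convex cone of strictly submodular $\mathbf{y}\in\mathscr{E}_K^L$, i.e. $y_S+y_T>y_{S\cap T}+y_{S\cup T}$ for all incomparable $S,T$ with $K\subset S,T\subset L$, where $y_K=y_L=0$. Projections: for $K\subseteq F\subset G\subseteq L$ define the linear map $\pi_F^G:\mathscr{E}_K^L\to\mathscr{E}_F^G$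 by $$\pi_F^G(\mathbf{t})=\Big(t_S-t_G\frac{|S\setminus F|}{|G\setminus F|}-t_F\frac{|G\setminus S|}{|G\setminus F|}\Big)_{F\subset S\subset G},\qquad t_K=t_L=0.$$ The polynomials: for $K<L$ in $\mathscr{P}$ let $r(K,L)$ be the rank (length of a maximal chain) of $[K,L]_{\mathscr{P}}$ and $d(K,L)=r(K,L)-1$. The polynomial $\mathrm{pol}_K^L(\mathbf{t})$, homogeneous of degree $d(K,L)$ in the variables $\{t_F:F\in\mathscr{P},\,K<F<L\}$, is defined recursively: $\mathrm{pol}_K^L=1$ if $d(K,L)=0$, and if $d(K,L)\ge1$, $$d(K,L)\cdot\mathrm{pol}_K^L(\mathbf{t})=\sum_{F\in\mathscr{P},\,K<F<L}t_F\cdot\mathrm{pol}_K^F(\pi_K^F(\mathbf{t}))\cdot\mathrm{pol}_F^L(\pi_F^L(\mathbf{t})).$$ $\mathscr{C}$-Lorentzian: for $\mathbf{u}\in\mathbb{R}^n$ let $D_{\mathbf{u}}=\sum_i u_i\partial_i$. For an open convex cone $\mathscr{C}\subseteq\mathbb{R}^n$, a homogeneous polynomial $g$ of degree $d$ is $\mathscr{C}$-Lorentzian if for all $\mathbf{v}_1,\ldots,\mathbf{v}_d\in\mathscr{C}$: (P) $D_{\mathbf{v}_1}\cdots D_{\mathbf{v}_d}g>0$, and (H) the symmetric bilinear form $(\mathbf{x},\mathbf{y})\mapsto D_{\mathbf{x}}D_{\mathbf{y}}D_{\mathbf{v}_3}\cdots D_{\mathbf{v}_d}g$ has exactly one positive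 eigenvalue, counted with multiplicity (vacuous if $d\le1$). The zero polynomial is by convention $\mathscr{C}$-Lorentzian. *)

(* Defs.v *)
From HB Require Import structures.
From mathcomp Require Import all_boot all_order all_algebra.
From mathcomp Require Import reals.
From mathcomp Require Import mpoly.

Set Implicit Arguments.
Unset Strict Implicit.
Unset Printing Implicit Defensive.

Import Order.TTheory GRing.Theory Num.Theory.
Local Open Scope ring_scope.

Section Posets.
Variable T : finType.
Implicit Types (P I C : {set {set T}}) (A B X : {set T}).

Definition set_itv P A B : {set {set T}} :=
  [set F in P | (A \subset F) && (F \subset B)].

Definition is_chain C : bool :=
  [forall A in C, forall B in C, (A \subset B) || (B \subset A)].

Definition maximal_chain I C : bool :=
  maxset (fun D : {set {set T}} => (D \subset I) && is_chain D) C.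

Definition graded I : Prop :=
  forall C D, maximal_chain I C -> maximal_chain I D -> #|C| = #|D|.

(* The length of a chain is its number of elements minus one. The maximum is  *)
(* immaterial when I is graded, see chain_rank_graded.                        *)
Definition chain_rank I : nat := (\max_(C | maximal_chain I C) #|C|).-1.

Lemma chain_rank_graded I C :
  graded I -> maximal_chain I C -> chain_rank I = #|C|.-1.
Proof.
move=> gI mC; congr _.-1; apply/eqP; rewrite eqn_leq.
rewrite (@leq_bigmax_cond _ _ (fun D : {set {set T}} => #|D|) C mC) andbT.
by apply/bigmax_leqP => D mD; rewrite (gI _ _ mD mC).
Qed.

Definition pdeg P A B : nat := (chain_rank (set_itv P A B)).-1.

Definition covers P A B : bool :=
  [&& A \in P, B \in P, B \proper A &
    [forall F in P, ~~ ((B \proper F) && (F \proper A))]].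

(* The flat axioms F1, F2, F3 for a family of subsets of the ground set X.    *)
(* In F3, the map A |-> A :\: H is injective on the sets covering H, so the   *)
(* set of blocks carries no hidden repetition.                                *)
Definition lattice_of_flats X P : Prop :=
  [/\ P \subset powerset X,
      X \in P,
      forall F G, F \in P -> G \in P -> F :&: G \in P
    & forall H, H \in P ->
        partition [set A :\: H | A in [set A | covers P A H]] (X :\: H)].

End Posets.

Notation strictly_between K L :=
  {S : {set _} | (K \proper S) && (S \proper L)}.

Section Spaces.
Variable T : finType.
Implicit Types K L F G S : {set T}.

(* t_S for an arbitrary set S; only used for K \subset S \subset L, where it  *)
(* implements the convention t_K = t_L = 0.                                   *)
Definition ext (V : nmodType) K L (t : {ffun strictly_between K L -> V}) S :
    V :=
  if insub S is Some s then t s else 0.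

Definition submod_cone (R : realFieldType) K L
    (y : {ffun strictly_between K L -> R}) : Prop :=
  forall S1 S2 : strictly_between K L,
    ~~ (val S1 \subset val S2) -> ~~ (val S2 \subset val S1) ->
    ext y (val S1 :&: val S2) + ext y (val S1 :|: val S2) < y S1 + y S2.

(* The values are taken in an arbitrary module V so that the map also applies *)
(* to the generic point, whose coordinates are the variables.                 *)
Definition projFG (R : fieldType) (V : lmodType R) K L F G
    (t : {ffun strictly_between K L -> V}) : {ffun strictly_between F G -> V} :=
  [ffun S => ext t (val S)
     - (#|val S :\: F|%:R / #|G :\: F|%:R) *: ext t G
     - (#|G :\: val S|%:R / #|G :\: F|%:R) *: ext t F].

End Spaces.

(* Polynomials in variables indexed by a finite type I are represented as     *)
(* {mpoly R[#|I|]}, the variable of s : I being 'X_(enum_rank s).             *)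

Section Polynomials.
Variables (R : fieldType) (T : finType).
Implicit Types (P : {set {set T}}) (K L F G : {set T}).

Definition nvars K L : nat := #|{: strictly_between K L}|.

Definition generic K L : {ffun strictly_between K L -> {mpoly R[nvars K L]}} :=
  [ffun S => 'X_(enum_rank S)].

Definition subst_proj K L F G (p : {mpoly R[nvars F G]}) :
    {mpoly R[nvars K L]} :=
  p \mPo [tuple projFG F G (generic K L) (enum_val i) | i < nvars F G].

(* m is fuel, decreasing with #|L :\: K|; pol_deg0 and polE give the actual   *)
(* recursion.                                                                 *)
Fixpoint pol_rec m P K L : {mpoly R[nvars K L]} :=
  if m is m'.+1 then
    if pdeg P K L == 0%N then 1 else
    (pdeg P K L)%:R^-1 *:
      \sum_(F in P | (K \proper F) && (F \proper L))
         ext (generic K L) F * subst_proj K L (pol_rec m' P K F)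
                             * subst_proj K L (pol_rec m' P F L)
  else 1.

Definition pol P K L : {mpoly R[nvars K L]} := pol_rec #|L :\: K| P K L.

Lemma card_setD_gt0 K L : K \proper L -> (0 < #|L :\: K|)%N.
Proof. by move=> KL; rewrite cardsDS ?proper_sub // subn_gt0 proper_card. Qed.

Lemma card_setD_lt K F L :
  K \proper F -> F \proper L ->
  (#|F :\: K| < #|L :\: K|)%N /\ (#|L :\: F| < #|L :\: K|)%N.
Proof.
move=> KF FL; have [sKF sFL] := (proper_sub KF, proper_sub FL).
have := proper_card KF; have := proper_card FL.
by rewrite !cardsDS ?(subset_trans sKF) // => FLc KFc; split;
  rewrite ?ltn_sub2r ?ltn_sub2l // (ltn_trans KFc).
Qed.

Lemma pol_rec_fuel m1 m2 P K L : K \proper L ->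
  (#|L :\: K| <= m1)%N -> (#|L :\: K| <= m2)%N ->
  pol_rec m1 P K L = pol_rec m2 P K L.
Proof.
elim: m1 m2 K L => [|m1 IH] m2 K L KL le1 le2.
  by move: (card_setD_gt0 KL); rewrite ltnNge le1.
case: m2 le2 => [|m2] le2;
  first by move: (card_setD_gt0 KL); rewrite ltnNge le2.
rewrite /=; case: eqP => // _; congr (_ *: _).
apply: eq_bigr => F /andP[_ /andP[KF FL]].
have [c1 c2] := card_setD_lt KF FL.
have le3 := leq_trans c1 le1; have le4 := leq_trans c1 le2.
have le5 := leq_trans c2 le1; have le6 := leq_trans c2 le2.
by rewrite (IH m2 K F KF le3 le4) (IH m2 F L FL le5 le6).
Qed.

Lemma pol_deg0 P K L : pdeg P K L = 0%N -> pol P K L = 1.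
Proof. by rewrite /pol; case: #|_| => //= m ->. Qed.

End Polynomials.

Lemma polE (R : realFieldType) (T : finType) (P : {set {set T}})
    (K L : {set T}) : K \proper L -> (1 <= pdeg P K L)%N ->
  (pdeg P K L)%:R *: pol R P K L =
  \sum_(F in P | (K \proper F) && (F \proper L))
     ext (generic R K L) F * subst_proj K L (pol R P K F)
                           * subst_proj K L (pol R P F L).
Proof.
move=> KL d_gt0; rewrite {1}/pol; case E : #|L :\: K| => [|m] /=.
  by have := card_setD_gt0 KL; rewrite E.
rewrite -[pdeg P K L == 0%N]negbK -lt0n d_gt0 /= scalerA.
rewrite mulfV ?pnatr_eq0 -?lt0n // scale1r.
apply: eq_bigr => F /andP[_ /andP[KF FL]].
have [] := card_setD_lt KF FL; rewrite E !ltnS => c1 c2.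
have e1 : pol_rec R m P K F = pol R P K F by apply: pol_rec_fuel.
have e2 : pol_rec R m P F L = pol R P F L by apply: pol_rec_fuel.
by rewrite e1 e2.
Qed.

(* subst_proj K L p is the polynomial t |-> p (projFG t).                     *)
Lemma meval_subst_proj (R : fieldType) (T : finType) (K L F G : {set T})
    (p : {mpoly R[nvars F G]}) (t : {ffun strictly_between K L -> R^o}) :
  (subst_proj K L p).@[fun i => t (enum_val i)] =
  p.@[fun i => projFG F G t (enum_val i)].
Proof.
rewrite /subst_proj comp_mpoly_meval; apply: meval_eq => i.
rewrite tnth_map tnth_ord_tuple !ffunE.
have Ext S : (ext (generic R K L) S).@[fun i => t (enum_val i)] = ext t S.
  by rewrite /ext; case: insubP => [s _ _|_];
    rewrite ?ffunE ?mevalXU ?enum_rankK ?meval0.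
by rewrite !mevalB !mevalZ !Ext.
Qed.

Section Lorentzian.
Variables (R : realFieldType) (I : finType).
Implicit Types (u v : {ffun I -> R}) (vs : seq {ffun I -> R}).
Implicit Types (p g : {mpoly R[#|I|]}).

Definition dirD u p : {mpoly R[#|I|]} :=
  \sum_(i : I) u i *: p^`M(enum_rank i).

Definition dirDs vs p : {mpoly R[#|I|]} := foldr dirD p vs.

Definition unitv (i : I) : {ffun I -> R} := [ffun j => (j == i)%:R].

Definition form_mx (B : {ffun I -> R} -> {ffun I -> R} -> R) : 'M[R]_#|I| :=
  \matrix_(i, j) B (unitv (enum_val i)) (unitv (enum_val j)).

Definition one_pos_eigenvalue n (M : 'M[R]_n) : Prop :=
  exists a, [/\ 0 < a, eigenvalue M a, mup a (char_poly M) = 1%N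
    & forall b, 0 < b -> eigenvalue M b -> b = a].

(* After d derivatives of a form of degree d one is left with a constant      *)
(* polynomial, whose value is its coefficient at the monomial 0.              *)
Definition lorentzian (C : {ffun I -> R} -> Prop) (d : nat) g : Prop :=
  g \is d.-homog /\
  (g = 0 \/
   forall vs : d.-tuple {ffun I -> R}, (forall v, v \in vs -> C v) ->
     0 < (dirDs vs g)@_0%MM /\
     ((2 <= d)%N ->
        one_pos_eigenvalue
          (form_mx
             (fun x y => (dirD x (dirD y (dirDs (drop 2 vs) g)))@_0%MM)))).

End Lorentzian.

(* Main.v *)
(* Write [q A B] for [pol A B] evaluated at the projection of the generic      *)
(* point to [A, B]. By induction on the rank,                                 *)
(*   D_v (q A B) = \sum_(A < G < B) v'_G (q A G) (q G B),                     *)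
(* v' being the projection of v, and the right-hand side vanishes when v' is  *)
(* modular. Hence the products of the [q A B] over the gaps of a chain of     *)
(* flats are stable under differentiation: each derivative inserts one more   *)
(* flat. As a strictly submodular function becomes positive after subtracting *)
(* a suitable modular one, the mixed derivatives along the cone are positive. *)
(* The signature condition is proved for all these products by induction on   *)
(* the degree. In degree 2 it is explicit. In degree at least 3, fix a        *)
(* direction b of the cone, with positive coordinates modulo lineality: the   *)
(* reverse Cauchy-Schwarz inequalities at b for the derivatives in the        *)
(* directions of the flats add up to a Bochner inequality H <= H^2 for the    *)
(* suitably rescaled Hessian, of which b is a Perron eigenvector since the    *)
(* comparability graph of the flats is connected. So 1 is its only positive   *)
(* eigenvalue.                                                                *)

(* The induction does not stay inside the family of interval polynomials, so the claim is proved for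
   every product [pch A s] over the gaps of a chain of flats. This class is closed under
   differentiation: [dirD_q] handles one interval, and [dirD_pch] follows by Leibniz.

   Positivity: modular functions act by zero ([Dsum_modular]), which rests on the partition axiom of
   flats. A strictly submodular function vanishing at both ends has a modular function strictly
   below it in between ([submod_strict_minorant]). So a derivative along the cone inserts flats with
   positive weights ([dirD_pch_pos]), and iterating down to degree 0 leaves a positive number
   ([pch_ev_gt0]).

   Signature: it suffices that the form is nonpositive on a hyperplane and positive somewhere
   ([hyperbolic_one_pos_eigenvalue]). In degree 2 the form is one square minus a sum of squares
   ([q_deg2_hyperbolic], [pch_deg2_hyperbolic]). In higher degree, hyperbolicity of the products
   with one more flat gives the inequality required by [perron_bochner]; [hyperbolic_bochner]
   carries out this step and [pch_hyperbolic] the induction. *)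
Require Import Defs.
From mathcomp Require Import all_boot all_order all_algebra.
From mathcomp Require Import reals.
From HB Require Import structures.
From mathcomp Require Import mpoly complex sesquilinear spectral ring lra.

Set Implicit Arguments.
Unset Strict Implicit.
Unset Printing Implicit Defensive.

Import Order.TTheory GRing.Theory Num.Theory.
Local Open Scope ring_scope.

(** * Real symmetric matrices *)

Section RealSymmetric.
Variable R : rcfType.

(* [a k] and [b k] are the real and imaginary parts of the vectors of a unitary *)
(* eigenbasis.                                                                *)
Lemma real_symmetric_spectral n (A : 'M[R]_n) : A^T = A ->
  exists (d : 'I_n -> R) (a b : 'I_n -> 'I_n -> R),
  [/\ (forall k i, \sum_j A i j * a k j = d k * a k i) /\
      (forall k i, \sum_j A i j * b k j = d k * b k i),
      (forall k l, \sum_i (a k i * a l i + b k i * b l i) = (k == l)%:R),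
      (forall k l, \sum_i (b k i * a l i - a k i * b l i) = 0),
      (forall i j, \sum_k (a k i * a k j + b k i * b k j) = (i == j)%:R)
    & char_poly A = \prod_k ('X - (d k)%:P)].
Proof.
move=> symA; pose toC := real_complex R; pose AC := map_mx toC A.
have herA : AC \is hermsymmx.
  apply/is_hermitianmxP; rewrite expr0 scale1r; apply/matrixP => i j.
  rewrite !mxE -[in LHS]symA mxE.
  by rewrite [RHS](_ : _ = (toC (A j i))^*%C) // conjc_real.
have /mxOverP dr := hermitian_spectral_diag_real herA.
have nA := hermitian_normalmx herA.
have /orthomx_spectralP eA := nA.
have := dr; have := eA; have := spectral_unitarymx AC.
set U := spectralmx AC; set D := spectral_diag AC => Uu {}eA {}dr.
have Uun := unitarymx_unit Uu.
exists (fun k => complex.Re (D 0 k)), (fun k i => complex.Re (U k i)), (fun k i => complex.Im (U k i)).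
have dE k : D 0 k = (complex.Re (D 0 k))%:C%C by rewrite RRe_real.
have eig k i : \sum_j AC i j * U k j = D 0 k * U k i.
  have : U *m AC = diag_mx D *m U by rewrite eA !mulmxA mulmxV // mul1mx.
  move=> /matrixP/(_ k i); rewrite mul_diag_mx [RHS]mxE => <-.
  rewrite mxE; apply: eq_bigr => j _; rewrite mulrC !mxE; congr (_ * _%:C%C).
  by rewrite -[in LHS]symA mxE.
have oR k l : \sum_i U k i * (U l i)^*%C = (k == l)%:R.
  have /matrixP/(_ k l) := elimT unitarymxP Uu.
  rewrite [X in _ = X -> _]mxE => <-; rewrite mxE.
  by apply: eq_bigr => i _; rewrite !mxE.
have oC i j : \sum_k U k j * (U k i)^*%C = (i == j)%:R.
  have : invmx U *m U = 1%:M by rewrite mulVmx.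
  rewrite invmx_unitary // => /matrixP/(_ i j).
  rewrite [X in _ = X -> _]mxE => <-; rewrite mxE.
  by apply: eq_bigr => k _; rewrite !mxE mulrC.
have ReS (F : 'I_n -> R[i]) : complex.Re (\sum_i F i) = \sum_i complex.Re (F i).
  by apply: (big_morph _ (fun x y => _) _) => // -[? ?] [? ?].
have ImS (F : 'I_n -> R[i]) : complex.Im (\sum_i F i) = \sum_i complex.Im (F i).
  by apply: (big_morph _ (fun x y => _) _) => // -[? ?] [? ?].
split.
- split=> k i; [have := congr1 (@complex.Re R) (eig k i) | have := congr1 (@complex.Im R) (eig k i)].
  + rewrite ReS dE; case: (U k i) => x y /=; rewrite mul0r subr0 => <-.
    by apply: eq_bigr => j _; rewrite !mxE; case: (U k j) => ? ? /=; ring.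
  + rewrite ImS dE; case: (U k i) => x y /=; rewrite mul0r addr0 => <-.
    by apply: eq_bigr => j _; rewrite !mxE; case: (U k j) => ? ? /=; ring.
- move=> k l; have := congr1 (@complex.Re R) (oR k l).
  rewrite ReS (_ : complex.Re (k == l)%:R = (k == l)%:R); last by case: eqP.
  move=> <-; apply: eq_bigr => i _.
  by case: (U k i) (U l i) => ? ? [? ?] /=; ring.
- move=> k l; have := congr1 (@complex.Im R) (oR k l).
  rewrite ImS (_ : complex.Im (k == l)%:R = 0); last by case: eqP.
  move=> h; rewrite -[RHS]h; apply: eq_bigr => i _.
  by case: (U k i) (U l i) => ? ? [? ?] /=; ring.
- move=> i j; have := congr1 (@complex.Re R) (oC i j).
  rewrite ReS (_ : complex.Re (i == j)%:R = (i == j)%:R); last by case: eqP.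
  move=> <-; apply: eq_bigr => k _.
  by case: (U k i) (U k j) => ? ? [? ?] /=; ring.
(* Over the complex numbers [A] is similar to the diagonal matrix; injectivity of the embedding
   brings the factorization back to [R]. *)
- apply: (map_poly_inj toC); rewrite map_char_poly rmorph_prod /=.
  have -> : char_poly (map_mx toC A) = char_poly (diag_mx D).
    pose U' := map_mx (@polyC _) U; pose V := map_mx (@polyC _) (invmx U).
    have VU : V *m U' = 1%:M by rewrite -map_mxM mulVmx // map_mx1.
    rewrite /char_poly -/AC (_ : char_poly_mx AC = V *m char_poly_mx (diag_mx D) *m U').
      have dVU : \det V * \det U' = 1 by rewrite -det_mulmx VU det1.
      by rewrite !det_mulmx mulrAC dVU mul1r.
    have VXU : V *m 'X%:M *m U' = 'X%:M by rewrite scalar_mxC -mulmxA VU mulmx1.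
    by rewrite /char_poly_mx mulmxBr mulmxBl VXU -!map_mxM -eA.
  rewrite char_poly_trig ?diag_mx_is_trig //; apply: eq_bigr => k _.
  by rewrite mxE eqxx mulr1n rmorphB /= map_polyX map_polyC /= -dE.
Qed.

End RealSymmetric.

(** * Quadratic forms with one positive eigenvalue *)

Section Hyperbolic.
Variable R : rcfType.

Definition qform n (A : 'M[R]_n) (x : 'I_n -> R) : R :=
  \sum_i x i * \sum_j A i j * x j.

(** The vectors [a k], [b k] are twice too many to be a basis, but the completeness relation makes
    them a Parseval frame, which suffices to expand [x] and diagonalize the form. *)
Lemma qform_spectral n (A : 'M[R]_n) (d : 'I_n -> R) (a b : 'I_n -> 'I_n -> R) :
  (forall k i, \sum_j A i j * a k j = d k * a k i) ->
  (forall k i, \sum_j A i j * b k j = d k * b k i) ->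
  (forall i j, \sum_k (a k i * a k j + b k i * b k j) = (i == j)%:R) ->
  forall x, qform A x =
    \sum_k d k * ((\sum_i x i * a k i) ^+ 2 + (\sum_i x i * b k i) ^+ 2).
Proof.
move=> eiga eigb comp x.
have xE j : x j = \sum_k ((\sum_i x i * a k i) * a k j
                          + (\sum_i x i * b k i) * b k j).
  transitivity (\sum_k \sum_i x i * (a k i * a k j + b k i * b k j)).
    rewrite exchange_big /= (bigD1 j) //= -mulr_sumr comp eqxx mulr1.
    rewrite big1 ?addr0 // => i /negPf ij.
    by rewrite -mulr_sumr comp ij mulr0.
  apply: eq_bigr => k _; rewrite !mulr_suml -big_split /=.
  by apply: eq_bigr => i _; ring.
have AxE i : \sum_j A i j * x j = \sum_k d k * ((\sum_i x i * a k i) * a k i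
                          + (\sum_i x i * b k i) * b k i).
  transitivity (\sum_j \sum_k A i j * ((\sum_i x i * a k i) * a k j
                          + (\sum_i x i * b k i) * b k j)).
    by apply: eq_bigr => j _; rewrite {1}(xE j) mulr_sumr.
  rewrite exchange_big /=; apply: eq_bigr => k _.
  transitivity (\sum_j ((\sum_i x i * a k i) * (A i j * a k j)
                          + (\sum_i x i * b k i) * (A i j * b k j))).
    by apply: eq_bigr => j _; ring.
  by rewrite big_split /= -!mulr_sumr eiga eigb; ring.
rewrite /qform; transitivity (\sum_i \sum_k x i * (d k *
   ((\sum_i x i * a k i) * a k i + (\sum_i x i * b k i) * b k i))).
  by apply: eq_bigr => i _; rewrite AxE mulr_sumr.
rewrite exchange_big /=; apply: eq_bigr => k _.
transitivity (\sum_i (d k * ((\sum_i x i * a k i) * (x i * a k i)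
   + (\sum_i x i * b k i) * (x i * b k i)))).
  by apply: eq_bigr => i _; ring.
by rewrite -mulr_sumr big_split /= -!mulr_sumr.
Qed.

(** Two positive eigenvalues, distinct or repeated, would span a plane on which the form is positive
    definite, and this plane would meet the hyperplane. Indexing eigenvalues by [k] takes care of
    multiplicity. *)
Lemma hyperbolic_one_pos_eigenvalue n (A : 'M[R]_n) (c : 'I_n -> R) :
  A^T = A ->
  (forall x, \sum_i c i * x i = 0 -> qform A x <= 0) ->
  (exists x, 0 < qform A x) -> one_pos_eigenvalue A.
Proof.
move=> symA hypA [x0 x0gt0].
have [d [a [b [[eiga eigb] norm orth comp chi]]]] := real_symmetric_spectral symA.
have [k dk | allneg] := pickP (fun k => 0 < d k); last first.
  suff : qform A x0 <= 0 by rewrite leNgt x0gt0.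
  rewrite (qform_spectral eiga eigb comp) sumr_le0 // => k _.
  by rewrite mulr_le0_ge0 ?addr_ge0 ?sqr_ge0 // leNgt allneg.
have uniq_pos l : l != k -> d l <= 0.
  move=> lk; rewrite leNgt; apply/negP => dl.
  have [p pE] : exists p, \sum_i c i * a k i = p by eexists.
  have [q qE] : exists q, \sum_i c i * b k i = q by eexists.
  have [r rE] : exists r, \sum_i c i * a l i = r by eexists.
  have [s sE] : exists s, \sum_i c i * b l i = s by eexists.
  have evalc (t1 t2 t3 t4 : R) :
      \sum_i c i * (t1 * a k i + t2 * b k i + t3 * a l i + t4 * b l i) =
      t1 * p + t2 * q + t3 * r + t4 * s.
    rewrite -pE -qE -rE -sE !mulr_sumr -!big_split /=.
    by apply: eq_bigr => i _; ring.
  have evalA (t1 t2 t3 t4 : R) i :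
      \sum_j A i j * (t1 * a k j + t2 * b k j + t3 * a l j + t4 * b l j) =
      d k * (t1 * a k i + t2 * b k i) + d l * (t3 * a l i + t4 * b l i).
    transitivity (t1 * (d k * a k i) + t2 * (d k * b k i)
      + t3 * (d l * a l i) + t4 * (d l * b l i)); last by ring.
    rewrite -!eiga -!eigb !mulr_sumr -!big_split /=.
    by apply: eq_bigr => j _; ring.
  (* The complex vector [(r + i s)(a k + i b k) - (p + i q)(a l + i b l)] is   *)
  (* killed by [c]; [z1] and [z2] are its real and imaginary parts.            *)
  pose z1 i := r * a k i + (- s) * b k i + (- p) * a l i + q * b l i.
  pose z2 i := s * a k i + r * b k i + (- q) * a l i + (- p) * b l i.
  have z1le : qform A z1 <= 0 by apply: hypA; rewrite evalc; ring.
  have z2le : qform A z2 <= 0 by apply: hypA; rewrite evalc; ring.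
  have zE : qform A z1 + qform A z2 =
      d k * (r ^+ 2 + s ^+ 2) + d l * (p ^+ 2 + q ^+ 2).
    have nk : \sum_i (a k i * a k i + b k i * b k i) = 1 by rewrite norm eqxx.
    have nl : \sum_i (a l i * a l i + b l i * b l i) = 1 by rewrite norm eqxx.
    have o1 : \sum_i (a k i * a l i + b k i * b l i) = 0.
      by rewrite norm eq_sym (negPf lk).
    have o2 := orth k l.
    transitivity (d k * (r ^+ 2 + s ^+ 2) *
          (\sum_i (a k i * a k i + b k i * b k i))
      + d l * (p ^+ 2 + q ^+ 2) * (\sum_i (a l i * a l i + b l i * b l i))
      - (d k + d l) * (r * p + s * q) *
          (\sum_i (a k i * a l i + b k i * b l i))
      + (d k + d l) * (s * p - r * q) *
          (\sum_i (b k i * a l i - a k i * b l i))); last first.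
      by rewrite nk nl o1 o2; ring.
    rewrite -mulNr /qform.
    rewrite !mulr_sumr -!big_split /=; apply: eq_bigr => i _.
    by rewrite !evalA /z1 /z2; ring.
  have [rs0 pq0] : r ^+ 2 + s ^+ 2 = 0 /\ p ^+ 2 + q ^+ 2 = 0.
    have g1 : 0 <= r ^+ 2 + s ^+ 2 by rewrite addr_ge0 ?sqr_ge0.
    have g2 : 0 <= p ^+ 2 + q ^+ 2 by rewrite addr_ge0 ?sqr_ge0.
    have h1 := mulr_ge0 (ltW dk) g1; have h2 := mulr_ge0 (ltW dl) g2.
    have h3 : d k * (r ^+ 2 + s ^+ 2) = 0 by lra.
    have h4 : d l * (p ^+ 2 + q ^+ 2) = 0 by lra.
    move/eqP: h3; move/eqP: h4; rewrite !mulf_eq0 (gt_eqF dk) (gt_eqF dl) /=.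
    by move=> /eqP-> /eqP->.
  have [p0 q0] : p = 0 /\ q = 0.
    move/eqP: pq0; rewrite paddr_eq0 ?sqr_ge0 // !sqrf_eq0.
    by case/andP => /eqP-> /eqP->.
  (* Now [c] kills [a k] and [b k] themselves, although the values of the form there add up to
     [d k], which is positive. *)
  have h1 := hypA (a k) (etrans pE p0).
  have h2 := hypA (b k) (etrans qE q0).
  have : qform A (a k) + qform A (b k) = d k.
    have nk : \sum_i (a k i * a k i + b k i * b k i) = 1 by rewrite norm eqxx.
    rewrite -[RHS]mulr1 -nk mulr_sumr /qform -big_split /=; apply: eq_bigr => i _.
    by rewrite eiga eigb; ring.
  by move=> dE; move: dk; rewrite -dE ltNge; case/negP; lra.
have rootE x : root (char_poly A) x -> exists l, x = d l.
  rewrite chi /root horner_prod prodf_seq_eq0 => /hasP[l _ /=].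
  by rewrite hornerXsubC subr_eq0 => /eqP ->; exists l.
exists (d k); split=> //.
- rewrite eigenvalue_root_char chi /root horner_prod (bigD1 k) //=.
  by rewrite hornerXsubC subrr mul0r.
- rewrite chi (bigD1 k) //= mupMl; first by rewrite -['X - _]expr1 mup_XsubCX eqxx.
  rewrite /root horner_prod; apply/prodf_neq0 => l lk.
  rewrite hornerXsubC subr_eq0; apply: contraTneq dk => ->.
  by rewrite -leNgt uniq_pos.
- move=> x x_gt0; rewrite eigenvalue_root_char => /rootE[l xE].
  have [<-|lk] := eqVneq l k; first by rewrite xE.
  by move: x_gt0; rewrite xE ltNge uniq_pos.
Qed.

(* Bochner-type argument: after rescaling to a symmetric matrix [S] for which  *)
(* [v] becomes the Perron eigenvector of eigenvalue 1, the last hypothesis     *)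
(* says [S <= S ^+ 2], so that the other eigenvalues cannot be positive.       *)
Lemma perron_bochner n (H : 'M[R]_n) (v : 'I_n -> R)
    (Hv := fun i => \sum_j H i j * v j) :
  H^T = H -> (forall i, 0 < v i) -> (forall i, 0 < Hv i) ->
  (forall i j, i != j -> 0 <= H i j) ->
  (forall f : 'I_n -> R, (forall i j, i != j -> 0 < H i j -> f i = f j) ->
     forall i j, f i = f j) ->
  (forall x, qform H x <= \sum_i v i * (\sum_j H i j * x j) ^+ 2 / Hv i) ->
  forall x, \sum_i Hv i * x i = 0 -> qform H x <= 0.
Proof.
move=> symH v_gt0 Hv_gt0 H_ge0 conn boch x x0.
(* The scaling for which [m i * v i] is fixed by [S]: the entry of [S] applied to this vector is
   [Hv i / m i], that is [m i * v i]. *)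
pose m i := Num.sqrt (Hv i / v i).
have m_gt0 i : 0 < m i by rewrite sqrtr_gt0 divr_gt0.
have m2 i : m i ^+ 2 = Hv i / v i by rewrite sqr_sqrtr // ltW // divr_gt0.
have v0 i : v i != 0 by rewrite gt_eqF.
have m0 i : m i != 0 by rewrite gt_eqF.
have Hv0 i : Hv i != 0 by rewrite gt_eqF.
have HC i j : H i j = H j i by rewrite -[in LHS]symH mxE.
pose S := \matrix_(i, j) (H i j / (m i * m j)) : 'M[R]_n.
have symS : S^T = S by apply/matrixP => i j; rewrite !mxE HC [m j * _]mulrC.
have SE u i : \sum_j H i j * (u j / m j) = m i * \sum_j S i j * u j.
  rewrite mulr_sumr; apply: eq_bigr => j _; rewrite mxE.
  by field; rewrite !m0.
have qHS u : qform H (fun i => u i / m i) = qform S u.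
  rewrite /qform; apply: eq_bigr => i _; rewrite SE.
  by field; rewrite m0.
have [d [a [b [[eiga eigb] _ _ comp _]]]] := real_symmetric_spectral symS.
(* The inequality at an eigenvector [u] forces [e >= 1] unless [u] is zero, and the Dirichlet form
   below forces [e <= 1] in the same sense. Then [u] is proportional to [m i * v i], hence
   orthogonal to [m i * x i] by the hypothesis on [x]. *)
have key (e : R) (u : 'I_n -> R) : (forall i, \sum_j S i j * u j = e * u i) ->
    0 < e -> \sum_i m i * x i * u i = 0.
  move=> eigu e_gt0; pose s := \sum_i u i ^+ 2.
  have qS : qform S u = e * s.
    by rewrite /qform mulr_sumr; apply: eq_bigr => i _; rewrite eigu; ring.
  have le1 : 0 <= (e - 1) * s.
    have : e * s <= e ^+ 2 * s.
      rewrite -qS -qHS (le_trans (boch _)) // mulr_sumr ler_sum // => i _.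
      rewrite SE eigu le_eqVlt; apply/orP; left; apply/eqP.
      by rewrite -mulrA exprMn m2; field; rewrite v0 Hv0.
    rewrite -subr_ge0 -mulrBl (_ : e ^+ 2 - e = e * (e - 1)); last by ring.
    by rewrite -mulrA pmulr_rge0.
  pose f i := u i / (m i * v i).
  have uE i : u i = m i * v i * f i.
    by rewrite /f mulrC mulfVK // mulf_neq0.
  clearbody f.
  (* The Dirichlet form of [f], the ratio of [u] to the Perron vector. Diagonal entries of [H],
     whose sign is unknown, do not contribute. *)
  have gap : \sum_i \sum_j H i j * v i * v j * (f i - f j) ^+ 2 =
             2 * (1 - e) * s.
    transitivity (\sum_i (v i * f i ^+ 2 * \sum_j H i j * v j)
       + \sum_i (\sum_j H i j * v i * v j * f j ^+ 2)
       - 2 * \sum_i (v i * f i * \sum_j H i j * (v j * f j))).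
      rewrite mulr_sumr -big_split -sumrB /=; apply: eq_bigr => i _.
      rewrite !mulr_sumr -big_split -sumrB /=; apply: eq_bigr => j _; ring.
    have e1 : \sum_i (v i * f i ^+ 2 * \sum_j H i j * v j) = s.
      rewrite /s; apply: eq_bigr => i _; rewrite uE !exprMn m2 -/(Hv i).
      by field; rewrite v0.
    have e2 : \sum_i \sum_j H i j * v i * v j * f j ^+ 2 = s.
      rewrite exchange_big /= -e1; apply: eq_bigr => j _; rewrite mulr_sumr.
      by apply: eq_bigr => i _; rewrite HC; ring.
    have e3 : \sum_i (v i * f i * \sum_j H i j * (v j * f j)) = e * s.
      rewrite -qS -qHS /qform; apply: eq_bigr => i _.
      have vf k : v k * f k = u k / m k by rewrite uE; field; rewrite m0.
      by rewrite vf; congr (_ * _); apply: eq_bigr => j _; rewrite vf.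
    by rewrite e1 e2 e3; ring.
  have term_ge0 i j : 0 <= H i j * v i * v j * (f i - f j) ^+ 2.
    have [->|ij] := eqVneq i j; first by rewrite subrr expr0n /= mulr0.
    have Hij := H_ge0 i j ij; have vi := ltW (v_gt0 i); have vj := ltW (v_gt0 j).
    by rewrite mulr_ge0 ?sqr_ge0 // !mulr_ge0.
  have gap0 : \sum_i \sum_j H i j * v i * v j * (f i - f j) ^+ 2 = 0.
    apply/eqP; rewrite eq_le sumr_ge0 ?andbT; last by move=> i _; rewrite sumr_ge0.
    by rewrite gap (_ : _ * s = - (2 * ((e - 1) * s))); [lra | ring].
  have fconst i j : f i = f j.
    apply: conn i j => i j ij Hij.
    have /eqP := gap0; rewrite psumr_eq0; last by move=> *; rewrite sumr_ge0.
    move=> /allP/(_ i); rewrite mem_index_enum => /(_ isT) /=.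
    rewrite psumr_eq0 // => /allP/(_ j); rewrite mem_index_enum => /(_ isT) /=.
    rewrite mulf_eq0 sqrf_eq0 subr_eq0 !mulf_eq0.
    by rewrite (gt_eqF Hij) !(gt_eqF (v_gt0 _)) => /eqP.
  have [k _ | none] := pickP (fun k : 'I_n => true); last first.
    by rewrite big1 // => i _; have := none i.
  transitivity (f k * \sum_i Hv i * x i); last by rewrite x0 mulr0.
  rewrite mulr_sumr; apply: eq_bigr => i _; rewrite uE (fconst i k).
  transitivity (m i ^+ 2 * v i * f k * x i); first by ring.
  by rewrite m2; field; rewrite v0.
have -> : qform H x = qform S (fun i => m i * x i).
  have mK i : m i * x i / m i = x i by rewrite mulrAC mulfV // mul1r.
  rewrite -qHS /qform; apply: eq_bigr => i _; rewrite mK; congr (_ * _).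
  by apply: eq_bigr => j _; rewrite mK.
rewrite (qform_spectral eiga eigb comp) sumr_le0 // => k _.
have [dk|dk] := lerP (d k) 0.
  by rewrite mulr_le0_ge0 // addr_ge0 ?sqr_ge0.
by rewrite (key (d k) (a k)) // (key (d k) (b k)) // expr0n /= addr0 mulr0.
Qed.

End Hyperbolic.

(** * Ranks and flats *)

Definition btw (T : finType) (P : {set {set T}}) (A B G : {set T}) : bool :=
  (G \in P) && ((A \proper G) && (G \proper B)).

Section Rank.
Variables (T : finType) (P : {set {set T}}).
Implicit Types (A B C F G H : {set T}) (D : {set {set T}}).
Hypothesis gradedP : forall A B, A \in P -> B \in P -> A \subset B ->
  graded (set_itv P A B).

Lemma btwP A B G : reflect [/\ G \in P, A \proper G & G \proper B] (btw P A B G).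
Proof. by rewrite /btw; apply: and3P. Qed.

Lemma maximal_chain_ex I : exists D, maximal_chain I D.
Proof.
have [|D mD _] := @maxset_exists _ (fun D => (D \subset I) && is_chain D) set0.
  rewrite sub0set; apply/forallP => X; apply/implyP; by rewrite inE.
by exists D.
Qed.

Lemma maximal_chainP (I D : {set {set T}}) : maximal_chain I D ->
  [/\ {subset D <= I},
      {in D &, forall X Y : {set T}, (X \subset Y) || (Y \subset X)}
    & forall X, X \in I ->
       (forall Y, Y \in D -> (X \subset Y) || (Y \subset X)) -> X \in D].
Proof.
case/maxsetP => /andP[sDI /forall_inP chD] maxD; split; first exact/subsetP.
  by move=> X Y XD YD; exact: (forall_inP (chD X XD)).
move=> X XI cmpX; suff <- : X |: D = D by rewrite setU11.
apply: maxD (subsetUr _ _); rewrite subUset sub1set XI sDI /=.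
apply/forall_inP => Y; rewrite !inE => YD; apply/forall_inP => Z.
rewrite !inE => ZD; case/orP: YD => [/eqP->|YD]; case/orP: ZD => [/eqP->|ZD].
- by rewrite subxx.
- exact: cmpX.
- by rewrite orbC; exact: cmpX.
- exact: (forall_inP (chD Y YD)).
Qed.

Lemma maximal_chainI (I D : {set {set T}}) : {subset D <= I} ->
  {in D &, forall X Y : {set T}, (X \subset Y) || (Y \subset X)} ->
  (forall X, X \in I ->
       (forall Y, Y \in D -> (X \subset Y) || (Y \subset X)) -> X \in D) ->
  maximal_chain I D.
Proof.
move=> sDI chD maxD; apply/maxsetP; split.
  apply/andP; split; first exact/subsetP.
  by apply/forall_inP => X XD; apply/forall_inP => Y YD; exact: chD.
move=> D' /andP[/subsetP sD'I /forall_inP chD'] sDD'; apply/eqP.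
rewrite eqEsubset sDD' andbT; apply/subsetP => X XD'; apply: maxD.
  exact: sD'I.
by move=> Y YD; apply: (forall_inP (chD' X XD')); exact: (subsetP sDD').
Qed.

Lemma maximal_chain_ends A B D : A \in P -> B \in P -> A \subset B ->
  maximal_chain (set_itv P A B) D -> (A \in D) /\ (B \in D).
Proof.
move=> AP BP AB /maximal_chainP[sD _ maxD]; split; apply: maxD.
- by rewrite inE AP subxx AB.
- by move=> Y /sD; rewrite inE => /and3P[_ -> _].
- by rewrite inE BP AB subxx.
- by move=> Y /sD; rewrite inE => /and3P[_ _ ->]; rewrite orbT.
Qed.

Lemma maximal_chain_card A B D : A \in P -> B \in P -> A \proper B ->
  maximal_chain (set_itv P A B) D -> #|D| = (pdeg P A B).+2.
Proof.
move=> AP BP AB mD; have sAB := proper_sub AB.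
rewrite /pdeg (chain_rank_graded (gradedP AP BP sAB) mD).
have [AD BD] := maximal_chain_ends AP BP sAB mD.
have neAB : A != B by apply: contraTneq AB => ->; rewrite properxx.
have : (1 < #|D|)%N.
  have <- : #|[set A; B]| = 2%N by rewrite cards2 neAB.
  by apply: subset_leq_card; rewrite subUset !sub1set AD BD.
by case: #|D| => [|[|]].
Qed.

(** Maximal chains of the two halves meet exactly in [G], and their union is a maximal chain of the
    whole interval. The successor appears because [pdeg] is the rank minus one. *)
Lemma pdegD A G B : A \in P -> G \in P -> B \in P -> A \proper G -> G \proper B ->
  pdeg P A B = (pdeg P A G + pdeg P G B).+1.
Proof.
move=> AP GP BP AG GB; have AB := proper_trans AG GB.
have [sAG sGB] := (proper_sub AG, proper_sub GB).
have [D1 m1] := maximal_chain_ex (set_itv P A G).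
have [D2 m2] := maximal_chain_ex (set_itv P G B).
have [s1 c1 x1] := maximal_chainP m1; have [s2 c2 x2] := maximal_chainP m2.
have [_ G1] := maximal_chain_ends AP GP sAG m1.
have [G2 _] := maximal_chain_ends GP BP sGB m2.
have le1 X : X \in D1 -> [/\ X \in P, A \subset X & X \subset G].
  by move=> /s1; rewrite inE => /and3P.
have le2 X : X \in D2 -> [/\ X \in P, G \subset X & X \subset B].
  by move=> /s2; rewrite inE => /and3P.
have m12 : maximal_chain (set_itv P A B) (D1 :|: D2).
  apply: maximal_chainI.
  - move=> X; rewrite !inE => /orP[/le1[-> -> /subset_trans->//]|].
    by move=> /le2[-> GX ->]; rewrite (subset_trans sAG GX).
  - move=> X Y; rewrite !inE => /orP[X1|X2] /orP[Y1|Y2].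
    + exact: c1.
    + have [_ _ XG] := le1 _ X1; have [_ GY _] := le2 _ Y2.
      by rewrite (subset_trans XG GY).
    + have [_ GX _] := le2 _ X2; have [_ _ YG] := le1 _ Y1.
      by rewrite (subset_trans YG GX) orbT.
    + exact: c2.
  - move=> X; rewrite !inE => /and3P[XP AX XB] cmpX.
    have /orP[XG|GX] : (X \subset G) || (G \subset X).
      by apply: cmpX; rewrite inE G1.
    + apply/orP; left; apply: x1; first by rewrite inE XP AX XG.
      by move=> Y Y1; apply: cmpX; rewrite inE Y1.
    + apply/orP; right; apply: x2; first by rewrite inE XP XB GX.
      by move=> Y Y2; apply: cmpX; rewrite inE Y2 orbT.
have I12 : D1 :&: D2 = [set G].
  apply/setP => X; rewrite !inE; apply/andP/eqP => [[X1 X2]|->//].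
  have [_ _ XG] := le1 _ X1; have [_ GX _] := le2 _ X2.
  by apply/eqP; rewrite eqEsubset XG GX.
have := cardsUI D1 D2; rewrite I12 cards1.
rewrite (maximal_chain_card AP BP AB m12) (maximal_chain_card AP GP AG m1).
rewrite (maximal_chain_card GP BP GB m2).
by rewrite addn1 !addSn !addnS => -[].
Qed.

Lemma pdeg_btw A B G : A \in P -> B \in P -> btw P A B G ->
  pdeg P A B = (pdeg P A G + pdeg P G B).+1.
Proof. by move=> AP BP /btwP[GP AG GB]; exact: pdegD. Qed.

Lemma pdeg_gt0 A B : A \in P -> B \in P -> A \proper B -> (0 < pdeg P A B)%N ->
  exists G, btw P A B G.
Proof.
move=> AP BP AB d_gt0; have [D mD] := maximal_chain_ex (set_itv P A B).
have [s _ _] := maximal_chainP mD.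
have : ~~ (D \subset [set A; B]).
  apply/negP => /subset_leq_card; rewrite (maximal_chain_card AP BP AB mD).
  by rewrite cards2; case: (pdeg P A B) (A != B) d_gt0 => [|n] [].
case/subsetPn => G GD; rewrite !inE negb_or => /andP[GA GB].
move: (s G GD); rewrite inE => /and3P[GP sAG sGB]; exists G; apply/btwP; split=> //.
  by rewrite properEneq eq_sym GA.
by rewrite properEneq GB.
Qed.

Lemma btw_pdeg_gt0 A B G : A \in P -> B \in P -> btw P A B G ->
  (0 < pdeg P A B)%N.
Proof. by move=> AP BP bG; rewrite (pdeg_btw AP BP bG). Qed.

Lemma pdeg0_eq A B F : A \in P -> B \in P -> pdeg P A B = 0%N ->
  F \in P -> A \proper F -> F \subset B -> F = B.
Proof.
move=> AP BP d0 FP AF FB; apply/eqP; apply: contraT => neFB.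
have : btw P A B F by apply/btwP; split=> //; rewrite properEneq neFB.
by move/(btw_pdeg_gt0 AP BP); rewrite d0.
Qed.

Section Flats.
Variables K L : {set T}.
Hypothesis flatsKL : lattice_of_flats L (set_itv P K L).

Lemma flatsI F G : F \in P -> G \in P -> K \subset F -> K \subset G ->
  F \subset L -> G \subset L -> F :&: G \in P.
Proof.
move=> FP GP KF KG FL GL; have [_ _ closedI _] := flatsKL.
have := closedI F G; rewrite !inE FP GP KF KG FL GL => /(_ isT isT).
by case/and3P.
Qed.

(** The block of the partition at [A] containing [i] comes from a cover [c] in the whole lattice;
    [c :&: B] is a flat strictly above [A], so it is all of [c]. *)
Lemma flat_cover A B i : A \in P -> B \in P -> K \subset A -> A \subset B ->
  B \subset L -> i \in B -> i \notin A ->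
  exists c, [/\ c \in P, A \proper c, c \subset B, i \in c & pdeg P A c = 0%N].
Proof.
move=> AP BP KA AB BL iB iA; have [_ _ _ F3] := flatsKL.
have AI : A \in set_itv P K L by rewrite inE AP KA (subset_trans AB BL).
have /and3P[/eqP cov _ _] := F3 A AI.
have : i \in L :\: A by rewrite inE iA (subsetP BL).
rewrite -cov => /bigcupP[_ /imsetP[c cc ->]]; rewrite inE iA /= => ic.
move: cc; rewrite inE => /and4P[cI _ Ac /forall_inP minc].
move: (cI); rewrite inE => /and3P[cP Kc cL].
have AcB : A \proper c :&: B.
  rewrite properE subsetI AB proper_sub //=; apply/subsetPn; exists i => //.
  by rewrite inE ic.
have cBP : c :&: B \in P.
  by rewrite flatsI // (subset_trans KA AB).
have cBE : c :&: B = c.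
  apply/eqP; apply: contraT => ne.
  have /minc : c :&: B \in set_itv P K L.
    by rewrite inE cBP (subset_trans KA (proper_sub AcB)) subIset ?cL.
  by rewrite AcB properEneq ne subsetIl.
exists c; split=> //; first by rewrite -cBE subsetIr.
apply/eqP; rewrite -leqn0 leqNgt; apply/negP => /(pdeg_gt0 AP cP Ac).
case=> G /btwP[GP AG Gc].
have /minc : G \in set_itv P K L.
  by rewrite inE GP (subset_trans KA (proper_sub AG))
             (subset_trans (proper_sub Gc) cL).
by rewrite AG Gc.
Qed.

Lemma cover_sub A B c i : A \in P -> B \in P -> c \in P -> K \subset A ->
  B \subset L -> c \subset L -> A \proper c -> A \subset B -> pdeg P A c = 0%N ->
  i \in c -> i \in B -> i \notin A -> c \subset B.
Proof.
move=> AP BP cP KA BL cL Ac AB d0 ic iB iA.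
have cBP : c :&: B \in P.
  have Kc := subset_trans KA (proper_sub Ac).
  by rewrite flatsI // (subset_trans KA AB).
suff <- : c :&: B = c by rewrite subsetIr.
apply: (pdeg0_eq AP cP d0 cBP _ (subsetIl _ _)).
rewrite properE subsetI AB proper_sub //=; apply/subsetPn; exists i => //.
by rewrite inE ic.
Qed.

(** In rank two every intermediate flat covers [A], and two covers sharing a point outside [A]
    contain each other. *)
Lemma pdeg1_btw_uniq A B i : A \in P -> B \in P -> K \subset A -> A \proper B ->
  B \subset L -> pdeg P A B = 1%N -> i \in B -> i \notin A ->
  exists2 c, btw P A B c & forall G, btw P A B G -> (i \in G) = (G == c).
Proof.
move=> AP BP KA AB BL d1 iB iA.
have [c [cP Ac cB ic d0]] := flat_cover AP BP KA (proper_sub AB) BL iB iA.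
have neq_cB : c != B by apply/eqP => cE; rewrite cE d1 in d0.
have bc : btw P A B c by apply/btwP; split=> //; rewrite properEneq neq_cB.
exists c => // G /[dup] bG /btwP[GP AG GB]; apply/idP/eqP => [iG|->//].
have dG : pdeg P A G = 0%N.
  have := pdeg_btw AP BP bG; rewrite d1 => -[/esym/eqP].
  by rewrite addn_eq0 => /andP[/eqP].
have GL := subset_trans (proper_sub GB) BL; have cL := subset_trans cB BL.
apply/eqP; rewrite eqEsubset.
rewrite (cover_sub AP cP GP KA cL GL AG (proper_sub Ac) dG iG ic iA).
by rewrite (cover_sub AP GP cP KA GL cL Ac (proper_sub AG) d0 ic iG iA).
Qed.

(** The sets [G :\: A] partition [B :\: A]. This is the only fact about matroids behind the
    vanishing on modular functions. *)
Lemma pdeg1_sum (R : zmodType) A B (a : T -> R) : A \in P -> B \in P ->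
  K \subset A -> A \proper B -> B \subset L -> pdeg P A B = 1%N ->
  \sum_(G | btw P A B G) \sum_(i in G :\: A) a i = \sum_(i in B :\: A) a i.
Proof.
move=> AP BP KA AB BL d1.
rewrite (exchange_big_dep (mem (B :\: A))) /=; last first.
  move=> G i /btwP[_ _ /proper_sub/subsetP GB]; rewrite !inE.
  by case/andP=> -> /GB.
apply: eq_bigr => i; rewrite inE => /andP[iA iB].
have [c bc uc] := pdeg1_btw_uniq AP BP KA AB BL d1 iB iA.
rewrite (big_pred1 c) // => G /=; rewrite !inE iA /=.
have [bG|nbG] := boolP (btw P A B G); first exact: uc.
by apply/esym/negbTE; apply: contra nbG => /eqP->.
Qed.

(* Two atoms of an interval of rank at least 3 lie below a common proper       *)
(* element, which connects the comparability graph.                            *)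
Lemma btw_connected (S : Type) A B (f : {set T} -> S) : A \in P -> B \in P ->
  K \subset A -> A \proper B -> B \subset L -> (1 < pdeg P A B)%N ->
  (forall G G', btw P A B G -> btw P A B G' -> G \proper G' -> f G = f G') ->
  forall G G', btw P A B G -> btw P A B G' -> f G = f G'.
Proof.
move=> AP BP KA AB BL d2 fcmp.
have atom_below G : btw P A B G -> exists a i,
    [/\ btw P A B a, pdeg P A a = 0%N, i \in a, i \notin A & f G = f a].
  move=> /[dup] bG /btwP[GP AG GB].
  have [i iG iA] : exists2 i, i \in G & i \notin A.
    by case/properP: AG => _ [i iG iA]; exists i.
  have GL := subset_trans (proper_sub GB) BL.
  have [a [aP Aa aG ia d0]] := flat_cover AP GP KA (proper_sub AG) GL iG iA.
  have ba : btw P A B a by apply/btwP; split=> //; apply: sub_proper_trans GB.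
  exists a, i; split=> //; have [->//|ne] := eqVneq a G.
  by apply/esym/fcmp => //; rewrite properEneq ne.
move=> G G' /atom_below[a [i [ba da ia iA ->]]].
case/atom_below=> a' [i' [ba' da' ia' iA' ->]].
have [aP Aa aB] := btwP _ _ _ ba; have [aP' Aa' aB'] := btwP _ _ _ ba'.
have aL := subset_trans (proper_sub aB) BL.
have aL' := subset_trans (proper_sub aB') BL.
have [->//|ne] := eqVneq a a'.
have i'a : i' \notin a.
  apply: contra ne => i'a; rewrite eqEsubset.
  rewrite (cover_sub AP aP aP' KA aL aL' Aa' (proper_sub Aa) da' ia' i'a iA').
  by rewrite (cover_sub AP aP' aP KA aL' aL Aa (proper_sub Aa') da i'a ia' iA').
have Ka := subset_trans KA (proper_sub Aa).
have i'B : i' \in B by apply: (subsetP (proper_sub aB')).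
(* This [c] is the join of the two atoms; it has rank two above [A], so it is not [B]. *)
have [c [cP ac cB ic dc]] := flat_cover aP BP Ka (proper_sub aB) BL i'B i'a.
have dAc : pdeg P A c = 1%N by rewrite (pdegD AP aP cP) // da dc.
have neq_cB : c != B by apply: contraTneq d2 => <-; rewrite dAc.
have bc : btw P A B c.
  apply/btwP; split=> //; first exact: proper_trans ac.
  by rewrite properEneq neq_cB.
have cL := subset_trans cB BL.
have Ac := proper_trans Aa ac.
have a'c := cover_sub AP cP aP' KA cL aL' Aa' (proper_sub Ac) da' ia' ic iA'.
rewrite (fcmp a c) // (fcmp a' c) //.
by rewrite properEneq a'c andbT; apply/eqP => cE; rewrite cE dAc in da'.
Qed.

End Flats.
End Rank.

(** * Submodular functions *)

Section Submodular.
Variables (R : realFieldType) (T : finType).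
Implicit Types (A B S : {set T}) (g : {set T} -> R).

Definition strict_submod A B g : Prop := forall S1 S2,
  A \subset S1 -> A \subset S2 -> S1 \subset B -> S2 \subset B ->
  ~~ (S1 \subset S2) -> ~~ (S2 \subset S1) ->
  g (S1 :&: S2) + g (S1 :|: S2) < g S1 + g S2.

(* Greedy vertex of the base polytope, for an order ending with [x]. *)
Lemma greedy_last g A B x (a : T -> R) : A \subset B -> x \in B -> x \notin A ->
  strict_submod A B g ->
  \sum_(i in B :\ x :\: A) a i = g (B :\ x) ->
  (forall S, A \subset S -> S \subset B :\ x ->
     \sum_(i in S :\: A) a i <= g S) ->
  exists a' : T -> R,
    [/\ \sum_(i in B :\: A) a' i = g B,
        forall S, A \subset S -> S \subset B -> \sum_(i in S :\: A) a' i <= g S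
      & forall S, A \subset S -> S \proper B -> x \in S ->
          \sum_(i in S :\: A) a' i < g S].
Proof.
move=> AB xB xA sub sumB leS.
pose a' i := if i == x then g B - g (B :\ x) else a i.
have notx S : x \notin S -> \sum_(i in S :\: A) a' i = \sum_(i in S :\: A) a i.
  move=> xS; apply: eq_bigr => i; rewrite inE => /andP[_ iS]; rewrite /a' ifN //.
  by apply: contraNneq xS => <-.
have inx S : x \in S -> \sum_(i in S :\: A) a' i =
    g B - g (B :\ x) + \sum_(i in S :\ x :\: A) a i.
  move=> xS; rewrite (bigD1 x) /=; last by rewrite inE xA.
  rewrite {1}/a' eqxx; congr (_ + _).
  rewrite (_ : \sum_(i | _) _ = \sum_(i in S :\ x :\: A) a' i); last first.
    by apply: eq_bigl => i; rewrite !inE; case: eqP; rewrite ?andbF ?andbT.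
  by rewrite notx // !inE eqxx.
have AS S : A \subset S -> A \subset S :\ x.
  by move=> sAS; rewrite subsetD1 sAS.
(* Strict submodularity applies to [S] and [B :\ x], which are incomparable, with intersection
   [S :\ x] and union [B]. *)
have strict S : A \subset S -> S \proper B -> x \in S ->
    \sum_(i in S :\: A) a' i < g S.
  move=> sAS SB xS; rewrite inx //.
  have sSB := proper_sub SB.
  have := sub S (B :\ x) sAS (AS _ AB) sSB (subD1set _ _).
  rewrite subsetD1 xS andbF => /(_ isT).
  have -> : S :&: (B :\ x) = S :\ x.
    by rewrite setIDA (setIidPl sSB).
  have -> : S :|: (B :\ x) = B.
    apply/setP => i; rewrite !inE; case: eqVneq => [->|_] /=.
      by rewrite xS xB.
    by case: (boolP (i \in S)) => // /(subsetP sSB) ->.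
  have -> : ~~ (B :\ x \subset S).
    apply: contraL SB => BxS; rewrite properE sSB /= negbK.
    apply/subsetP => i iB; have [->//|ix] := eqVneq i x.
    by apply: (subsetP BxS); rewrite !inE ix.
  move=> /(_ isT); have := leS (S :\ x) (AS _ sAS) (setSD _ sSB); lra.
exists a'; split=> //; first by rewrite inx // sumB subrK.
move=> S sAS SB; have [xS|xS] := boolP (x \in S); last first.
  by rewrite notx // leS // subsetD1 SB.
have [->|neSB] := eqVneq S B; first by rewrite inx // sumB subrK.
by apply/ltW/strict => //; rewrite properEneq neSB.
Qed.

(** The greedy algorithm: elements of [B :\: A] are added one at a time, each receiving its marginal
    value. *)
Lemma submod_modular_minorant g A B : A \subset B -> strict_submod A B g ->
  g A = 0 ->
  exists a : T -> R, \sum_(i in B :\: A) a i = g B /\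
    forall S, A \subset S -> S \subset B -> \sum_(i in S :\: A) a i <= g S.
Proof.
move=> + + gA; have [n] := ubnP #|B :\: A|; elim: n B => // n IH B ltn AB sub.
have [<-|neAB] := eqVneq A B.
  exists (fun=> 0); split=> [|S AS SA]; first by rewrite big1.
  have -> : S = A by apply/eqP; rewrite eqEsubset SA.
  by rewrite gA big1.
have [x xB xA] : exists2 x, x \in B & x \notin A.
  by apply/subsetPn; apply: contra neAB => BA; rewrite eqEsubset AB.
have sub' : strict_submod A (B :\ x) g.
  move=> S1 S2 A1 A2 S1B S2B; apply: sub => //.
    exact: subset_trans S1B (subD1set _ _).
  exact: subset_trans S2B (subD1set _ _).
have [||a [sumB leS]] := IH (B :\ x) _ _ sub'; last first.
- have [a' [? ? _]] := greedy_last AB xB xA sub sumB leS; by exists a'.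
- by rewrite subsetD1 AB.
- rewrite -ltnS (leq_trans _ ltn) // ltnS; apply: proper_card.
  apply/properP; split; first by rewrite setSD // subD1set.
  by exists x; rewrite !inE ?xA // eqxx.
Qed.

(* The average of greedy vertices over the last element is in the interior. *)
Lemma submod_strict_minorant g A B : A \proper B -> strict_submod A B g ->
  g A = 0 -> g B = 0 ->
  exists a : T -> R, \sum_(i in B :\: A) a i = 0 /\
    forall S, A \proper S -> S \proper B -> \sum_(i in S :\: A) a i < g S.
Proof.
move=> AB sub gA gB; have sAB := proper_sub AB.
have /fin_all_exists[a aP] (x : T) : exists a : T -> R, x \in B :\: A ->
   [/\ \sum_(i in B :\: A) a i = g B,
       forall S, A \subset S -> S \subset B -> \sum_(i in S :\: A) a i <= g S
     & forall S, A \subset S -> S \proper B -> x \in S ->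
          \sum_(i in S :\: A) a i < g S].
  have [xBA|_] := boolP (x \in B :\: A); last by exists (fun=> 0).
  move: xBA; rewrite inE => /andP[xA xB].
  have sub' : strict_submod A (B :\ x) g.
    move=> S1 S2 A1 A2 S1B S2B; apply: sub => //.
      exact: subset_trans S1B (subD1set _ _).
    exact: subset_trans S2B (subD1set _ _).
  have [|a [sumB leS]] := submod_modular_minorant _ sub' gA.
    by rewrite subsetD1 sAB.
  have [a' ?] := greedy_last sAB xB xA sub sumB leS; by exists a'.
pose N : R := #|B :\: A|%:R.
have N_gt0 : 0 < N by rewrite ltr0n card_setD_gt0.
exists (fun i => N^-1 * \sum_(x in B :\: A) a x i); split=> [|S AS SB].
  rewrite -mulr_sumr exchange_big /= big1 ?mulr0 // => x xBA.
  by have [-> _ _] := aP x xBA.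
rewrite -mulr_sumr exchange_big /= mulrC ltr_pdivrMr // mulr_natr -sumr_const.
(* Only the greedy vectors whose last element lies in [S] give a strict inequality; one exists since
   [S] is larger than [A]. *)
case/properP: (AS) => sAS [x xS xA].
have xBA : x \in B :\: A by rewrite inE xA (subsetP (proper_sub SB)).
rewrite (bigD1 x) //= [ltRHS](bigD1 x) //=; apply: ltr_leD.
  by have [_ _] := aP x xBA; apply.
apply: ler_sum => y /andP[yBA _]; have [_ + _] := aP y yBA; apply=> //.
exact: proper_sub.
Qed.

End Submodular.

(** * Projections and directional derivatives *)

(* [rel f A B] is [f] minus the affine function of the cardinal that agrees    *)
(* with [f] at [A] and [B]; applied to a point it gives [projFG].              *)
Section Rel.
Variables (R : realFieldType) (T : finType) (V : lmodType R).
Implicit Types (A B F G S : {set T}) (f : {set T} -> V).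

Definition rel f A B S : V :=
  f S - (#|S :\: A|%:R / #|B :\: A|%:R) *: f B
      - (#|B :\: S|%:R / #|B :\: A|%:R) *: f A.

Lemma card_setD_neq0 A B : A \proper B -> #|B :\: A|%:R != 0 :> R.
Proof. by move=> AB; rewrite pnatr_eq0 -lt0n card_setD_gt0. Qed.

Lemma relA f A B : A \proper B -> rel f A B A = 0.
Proof.
move=> AB; rewrite /rel setDv cards0 mul0r scale0r subr0.
by rewrite divff ?card_setD_neq0 // scale1r subrr.
Qed.

Lemma relB f A B : A \proper B -> rel f A B B = 0.
Proof.
move=> AB; rewrite /rel setDv cards0 mul0r scale0r subr0.
by rewrite divff ?card_setD_neq0 // scale1r subrr.
Qed.

Lemma card_setD_natr A S B : A \subset S -> S \subset B ->
  #|B :\: S|%:R = #|B :\: A|%:R - #|S :\: A|%:R :> R.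
Proof.
move=> AS SB; have AB := subset_trans AS SB; rewrite !cardsDS //.
rewrite !natrB ?subset_leq_card //; ring.
Qed.

Lemma relD_scale f (c : {set T} -> R) (v : V) F G S :
  rel (fun X => f X - c X *: v) F G S =
  rel f F G S - (c S - #|S :\: F|%:R / #|G :\: F|%:R * c G
                   - #|G :\: S|%:R / #|G :\: F|%:R * c F) *: v.
Proof.
have subACA (x y z t : V) : (x - y) - (z - t) = (x - z) - (y - t).
  by rewrite !opprD addrACA.
rewrite /rel !scalerBr !scalerA !scalerBl.
by rewrite [X in X - _ = _]subACA [LHS]subACA.
Qed.

(** Successive projections compose, because the correction made by [rel f A B] is affine in the
    cardinal and the second projection annihilates it. *)
Lemma rel_rel f A B F G S : A \proper B -> F \proper G ->
  A \subset F -> F \subset S -> S \subset G -> G \subset B ->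
  rel (rel f A B) F G S = rel f F G S.
Proof.
move=> AB FG AF FS SG GB.
have dAB := card_setD_neq0 AB; have dFG := card_setD_neq0 FG.
have sFG := proper_sub FG; have AG := subset_trans AF sFG.
have AS := subset_trans AF FS; have SB := subset_trans SG GB.
have FB := subset_trans sFG GB.
have dSF := card_setD_natr AF FS; have dGF := card_setD_natr AF sFG.
rewrite [LHS](relD_scale (fun X => f X - (#|X :\: A|%:R / #|B :\: A|%:R) *: f B)
   (fun X => #|B :\: X|%:R / #|B :\: A|%:R)) relD_scale.
rewrite -addrA -opprD (_ : _ *: f B + _ = 0) ?subr0 //.
rewrite dGF in dFG *.
rewrite (card_setD_natr AS SB) (card_setD_natr AG GB) (card_setD_natr AF FB).
rewrite (card_setD_natr FS SG) dSF dGF.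
set x := (X in X *: f B + _); set y := (X in _ + X *: f A).
have -> : x = 0 by rewrite /x; field; rewrite dAB dFG.
have -> : y = 0 by rewrite /y; field; rewrite dAB dFG.
by rewrite !scale0r addr0.
Qed.

Lemma rel_splitA f A B G S : A \proper G -> G \proper B -> A \subset S ->
  S \subset G ->
  rel f A G S = rel f A B S - (#|S :\: A|%:R / #|G :\: A|%:R) *: rel f A B G.
Proof.
move=> AG GB AS SG; have AB := proper_trans AG GB.
rewrite -(rel_rel f AB AG (subxx A) AS SG (proper_sub GB)).
by have := relA f AB; move: (rel f A B) => y y0; rewrite /rel y0 scaler0 subr0.
Qed.

Lemma rel_splitB f A B G S : A \proper G -> G \proper B -> G \subset S ->
  S \subset B ->
  rel f G B S = rel f A B S - (#|B :\: S|%:R / #|B :\: G|%:R) *: rel f A B G.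
Proof.
move=> AG GB GS SB; have AB := proper_trans AG GB.
rewrite -(rel_rel f AB GB (proper_sub AG) GS SB (subxx B)).
by have := relB f AB; move: (rel f A B) => y y0; rewrite /rel y0 scaler0 subr0.
Qed.

End Rel.

Section CompMpoly.
Variables (R : comNzRingType).

Lemma comp_mpoly_comp n m k (p : {mpoly R[n]}) (s : n.-tuple {mpoly R[m]})
    (s' : m.-tuple {mpoly R[k]}) :
  (p \mPo s) \mPo s' = p \mPo [tuple tnth s i \mPo s' | i < n].
Proof.
elim/mpolyind: p => [|c mm p _ _ IH]; first by rewrite !comp_mpoly0.
rewrite !comp_mpolyD IH !comp_mpolyZ !comp_mpolyX rmorph_prod /=.
congr (_ *: _ + _); apply: eq_bigr => i _.
by rewrite rmorphXn /= tnth_mktuple.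
Qed.

End CompMpoly.

Section DirDerivative.
Variables (R : realFieldType) (I : finType).
Implicit Types (v : {ffun I -> R}) (p : {mpoly R[#|I|]}).

Lemma dirD_is_linear v : linear (dirD v).
Proof.
move=> c p p'; rewrite /dirD scaler_sumr -big_split /=; apply: eq_bigr => i _.
by rewrite mderivD mderivZ scalerDr !scalerA mulrC.
Qed.

HB.instance Definition _ v :=
  GRing.isLinear.Build R {mpoly R[#|I|]} {mpoly R[#|I|]} _ (dirD v)
    (dirD_is_linear v).

Lemma dirDM v p p' : dirD v (p * p') = dirD v p * p' + p * dirD v p'.
Proof.
rewrite /dirD mulr_suml mulr_sumr -big_split /=; apply: eq_bigr => i _.
by rewrite mderivM scalerDr scalerAl scalerAr.
Qed.

Lemma dirDC v c : dirD v c%:MP = 0.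
Proof. by rewrite /dirD big1 // => i _; rewrite mderivC scaler0. Qed.

Lemma dirD1 v : dirD v 1 = 0.
Proof. by rewrite -mpolyC1 dirDC. Qed.

Lemma dirDXU v i : dirD v 'X_(enum_rank i) = (v i)%:MP.
Proof.
rewrite /dirD (bigD1 i) //= big1 => [|j ji].
  rewrite mderivX mnm1E eqxx scale1r.
  have -> : (U_(enum_rank i) - U_(enum_rank i) = 0)%MM.
    by apply/mnmP => k; rewrite mnmBE subnn mnm0E.
  by rewrite mpolyX0 addr0 alg_mpolyC.
rewrite mderivX mnm1E (inj_eq enum_rank_inj) eq_sym (negPf ji).
by rewrite scale0r scaler0.
Qed.

Lemma dirD_comm v v' p : dirD v (dirD v' p) = dirD v' (dirD v p).
Proof.
rewrite /dirD; transitivity (\sum_i \sum_j (v i * v' j) *: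
    p^`M(enum_rank j)^`M(enum_rank i)).
  apply: eq_bigr => i _; rewrite (raddf_sum (mderiv _)) scaler_sumr.
  by apply: eq_bigr => j _; rewrite /= mderivZ scalerA.
rewrite exchange_big /=; apply: eq_bigr => j _; rewrite (raddf_sum (mderiv _)) scaler_sumr.
by apply: eq_bigr => i _; rewrite /= mderivZ scalerA mulrC mderiv_comm.
Qed.

End DirDerivative.

(** * The polynomials on an interval *)

Section ProjectedPolynomials.
Variables (R : realFieldType) (T : finType) (P : {set {set T}}).
Variables (K L : {set T}).
Implicit Types (A B F G H S : {set T}).
Local Notation M := {mpoly R[nvars K L]}.
Implicit Types (f g : {set T} -> M) (v : {ffun strictly_between K L -> R}).

(** At the endpoints both sides vanish: the left by the convention of [ext], the right by
    normalization. *)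
Lemma ext_projFG (V : lmodType R) (t : {ffun strictly_between K L -> V}) A B S :
  A \proper B -> A \subset S -> S \subset B ->
  ext (projFG A B t) S = rel (ext t) A B S.
Proof.
move=> AB AS SB; rewrite /ext; case: insubP => [s _ sS|].
  by rewrite ffunE sS /rel -/(ext t _).
rewrite negb_and !properE AS SB !negbK /= => /orP[SA|BS].
  by rewrite (_ : S = A) ?relA //; apply/eqP; rewrite eqEsubset SA.
by rewrite (_ : S = B) ?relB //; apply/eqP; rewrite eqEsubset BS SB.
Qed.

Definition gen S : M := ext (generic R K L) S.
Definition cst v S : M := (ext (v : {ffun _ -> R^o}) S)%:MP.
Definition q A B : M := subst_proj K L (pol R P A B).

Lemma subst_proj_ext A B S : A \proper B -> A \subset S -> S \subset B ->
  subst_proj K L (ext (generic R A B) S) = rel gen A B S.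
Proof.
move=> AB AS SB; rewrite -[RHS]ext_projFG // /subst_proj /ext.
case: insubP => [s _ _|_]; last by rewrite comp_mpoly0.
by rewrite [generic R A B]/generic ffunE comp_mpolyXU -tnth_nth tnth_mktuple
           enum_rankK.
Qed.

Lemma subst_proj_subst_proj A B F G (p : {mpoly R[nvars F G]}) :
  A \proper B -> A \subset F -> F \proper G -> G \subset B ->
  subst_proj K L (subst_proj A B p) = subst_proj K L p.
Proof.
move=> AB AF FG GB; rewrite [subst_proj A B p]/subst_proj.
rewrite /subst_proj comp_mpoly_comp; congr (_ \mPo _).
apply: eq_from_tnth => i; rewrite !tnth_mktuple.
have := valP (enum_val i); set S := enum_val i => /andP[FS SG].
have -> : projFG F G (generic R A B) S = rel (ext (generic R A B)) F G (val S).
  by rewrite ffunE.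
have -> : projFG F G (generic R K L) S = rel gen F G (val S) by rewrite ffunE.
have [sFG sFS sSG] := And3 (proper_sub FG) (proper_sub FS) (proper_sub SG).
have sAG := subset_trans AF sFG; have sFB := subset_trans sFG GB.
have sAS := subset_trans AF sFS; have sSB := subset_trans sSG GB.
rewrite {1}/rel !comp_mpolyB !comp_mpolyZ -!/(subst_proj K L _).
by rewrite !subst_proj_ext // -[RHS](rel_rel gen AB FG).
Qed.

Lemma q_id : K \proper L -> q K L = pol R P K L.
Proof.
move=> KL; rewrite /q /subst_proj -[RHS]comp_mpoly_id; congr (_ \mPo _).
apply: eq_from_tnth => i; rewrite !tnth_mktuple ffunE.
have extK : ext (generic R K L) K = 0.
  by rewrite /ext insubF // properxx.
have extL : ext (generic R K L) L = 0.
  by rewrite /ext insubF // properxx andbF.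
rewrite extK extL !scaler0 !subr0 /ext valK ffunE enum_valK.
by [].
Qed.

Lemma q_deg0 A B : pdeg P A B = 0%N -> q A B = 1.
Proof. by move=> d0; rewrite /q pol_deg0 // /subst_proj comp_mpoly1. Qed.

(** The right-hand side of the recursion with a free function in place of the variables. At [gen] it
    is the degree times [q A B] (Euler), at [cst v] it is the derivative along [v]. *)
Definition Dsum f A B : M :=
  \sum_(G | btw P A B G) rel f A B G * q A G * q G B.

Lemma q_rec A B : A \proper B -> (0 < pdeg P A B)%N ->
  (pdeg P A B)%:R *: q A B = Dsum gen A B.
Proof.
move=> AB d_gt0; rewrite -comp_mpolyZ polE // /Dsum.
rewrite (raddf_sum (comp_mpoly _)) /=; apply: eq_bigr => G /and3P[GP AG GB].
rewrite !rmorphM /= -!/(subst_proj K L _).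
have [sAG sGB] := (proper_sub AG, proper_sub GB).
by rewrite subst_proj_ext // !subst_proj_subst_proj.
Qed.

Lemma dirD_gen v S : dirD v (gen S) = cst v S.
Proof.
rewrite /gen /cst /ext; case: insubP => [s _ _|_]; last by rewrite linear0 mpolyC0.
by rewrite ffunE dirDXU.
Qed.

Lemma dirD_rel v f A B S :
  dirD v (rel f A B S) = rel (fun S => dirD v (f S)) A B S.
Proof. by rewrite /rel !linearB !linearZ. Qed.

Lemma dirD_rel_gen v A B S : dirD v (rel gen A B S) = rel (cst v) A B S.
Proof. by rewrite dirD_rel /rel !dirD_gen. Qed.

Lemma rel_mpolyC (c : {set T} -> R) A B S :
  rel (fun S => (c S)%:MP : M) A B S = (rel (c : {set T} -> R^o) A B S)%:MP.
Proof. by rewrite /rel !mpolyCB -!mul_mpolyC -!mpolyCM. Qed.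

(* The inner sums enumerate the chains [A < H < G < B] twice; the coefficient *)
(* of each such chain is symmetric in [f] and [g].                            *)
Lemma Dsum_exchange f g A B :
  \sum_(G | btw P A B G) rel f A B G * (Dsum g A G * q G B + q A G * Dsum g G B)
  = \sum_(G | btw P A B G)
      rel g A B G * (Dsum f A G * q G B + q A G * Dsum f G B).
Proof.
have expand (h k : {set T} -> M) : \sum_(G | btw P A B G) rel h A B G *
        (Dsum k A G * q G B + q A G * Dsum k G B) =
    \sum_(G | btw P A B G) \sum_(H | btw P A G H)
      (rel h A B G * rel k A G H + rel h A B H * rel k H B G)
        * (q A H * q H G * q G B).
  transitivity (\sum_(G | btw P A B G) \sum_(H | btw P A G H)
        rel h A B G * rel k A G H * (q A H * q H G * q G B)
    + \sum_(H | btw P A B H) \sum_(G | btw P H B G)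
        rel h A B H * rel k H B G * (q A H * q H G * q G B)).
    rewrite -big_split /=; apply: eq_bigr => G bG.
    rewrite mulrDr /Dsum; congr (_ + _).
      by rewrite mulr_suml mulr_sumr; apply: eq_bigr => H _; ring.
    by rewrite !mulr_sumr; apply: eq_bigr => H _; ring.
  rewrite [X in _ + X](exchange_big_dep (btw P A B)) /=; last first.
    move=> H G /btwP[HP AH HB] /btwP[GP HG GB]; apply/btwP; split=> //.
    exact: proper_trans HG.
  rewrite -big_split /=; apply: eq_bigr => G bG.
  rewrite [X in _ + X](eq_bigl (btw P A G)); last first.
    case/btwP: bG => GP AG GB H.
    apply/andP/btwP => [[/btwP[HP AH _] /btwP[_ HG _]]|[HP AH HG]].
      by split.
    by split; apply/btwP; split=> //; exact: proper_trans HG GB.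
  rewrite -big_split /=; apply: eq_bigr => H _.
  by rewrite [RHS]mulrDl.
rewrite !expand; apply: eq_bigr => G /btwP[GP AG GB].
apply: eq_bigr => H /btwP[HP AH HG]; congr (_ * _).
have AB := proper_trans AG GB; have HB := proper_trans HG GB.
(* Relative to [A] and [B] the coefficient is [f_G g_H + f_H g_G] minus multiples of [f_G g_G] and
   [f_H g_H], visibly symmetric. *)
rewrite !(rel_splitA _ AG GB (proper_sub AH) (proper_sub HG)).
rewrite !(rel_splitB _ AH HB (proper_sub HG) (proper_sub GB)).
rewrite -!mul_mpolyC; move: (rel f A B) (rel g A B) => x y; ring.
Qed.

Section Derivative.
Hypothesis gradedP : forall A B, A \in P -> B \in P -> A \subset B ->
  graded (set_itv P A B).

Lemma Dsum0 f A B : A \in P -> B \in P -> pdeg P A B = 0%N -> Dsum f A B = 0.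
Proof.
move=> AP BP d0; rewrite /Dsum big1 // => G /(btw_pdeg_gt0 gradedP AP BP).
by rewrite d0.
Qed.

Lemma q_recE A B : A \in P -> B \in P -> A \proper B ->
  (pdeg P A B)%:R *: q A B = Dsum gen A B.
Proof.
move=> AP BP AB; case: (posnP (pdeg P A B)) => [d0|]; last exact: q_rec.
by rewrite Dsum0 // d0 scale0r.
Qed.

(** Euler's identity for each product [q A G * q G B], whose degree is one less than that of
    [q A B]. *)
Lemma Dsum_euler f A B : A \in P -> B \in P ->
  \sum_(G | btw P A B G)
      rel f A B G * (Dsum gen A G * q G B + q A G * Dsum gen G B)
  = (pdeg P A B).-1%:R *: Dsum f A B.
Proof.
move=> AP BP; rewrite /Dsum scaler_sumr; apply: eq_bigr => G bG.
rewrite (pdeg_btw gradedP AP BP bG) /=; case/btwP: bG => GP AG GB.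
rewrite -/(Dsum gen A G) -/(Dsum gen G B) -!q_recE // natrD -!mul_mpolyC mpolyCD.
ring.
Qed.

(** Differentiate the recursion. The derivative of the variables gives the desired sum once; by
    induction, [Dsum_exchange] and [Dsum_euler], the remaining terms give it [d - 1] more times, and
    the factor [d] cancels. *)
Lemma dirD_q v A B : A \in P -> B \in P -> A \proper B ->
  dirD v (q A B) = Dsum (cst v) A B.
Proof.
have [n] := ubnP (pdeg P A B).
elim: n A B => // n IH A B ltn AP BP AB.
case: (posnP (pdeg P A B)) => [d0|d_gt0]; first by rewrite Dsum0 // q_deg0 // dirD1.
have d0 : (pdeg P A B)%:R != 0 :> R by rewrite pnatr_eq0 -lt0n.
apply: (scalerI d0); rewrite -linearZ q_rec //= /Dsum linear_sum /=.
transitivity (Dsum (cst v) A B + \sum_(G | btw P A B G) rel gen A B G *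
     (Dsum (cst v) A G * q G B + q A G * Dsum (cst v) G B)).
  rewrite /Dsum -big_split /=; apply: eq_bigr => G bG.
  have := pdeg_btw gradedP AP BP bG; case/btwP: bG => GP AG GB dE.
  rewrite !dirDM dirD_rel_gen -!/(Dsum _ _ _) !IH //; first ring.
    by rewrite -ltnS (leq_trans _ ltn) // dE !ltnS leq_addl.
  by rewrite -ltnS (leq_trans _ ltn) // dE !ltnS leq_addr.
rewrite Dsum_exchange Dsum_euler // -[X in X + _]scale1r -scalerDl.
by rewrite -[1]/(1%:R) -natrD add1n prednK.
Qed.

Lemma q_homog A B : A \in P -> B \in P -> A \proper B ->
  q A B \is (pdeg P A B).-homog.
Proof.
have [n] := ubnP (pdeg P A B).
elim: n A B => // n IH A B ltn AP BP AB.
case: (posnP (pdeg P A B)) => [d0|d_gt0]; first by rewrite q_deg0 // d0 dhomog1.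
have d0 : (pdeg P A B)%:R != 0 :> R by rewrite pnatr_eq0 -lt0n.
rewrite -[q A B]scale1r -(mulVf d0) -scalerA rpredZ // q_rec //.
apply: rpred_sum => G bG.
have dE := pdeg_btw gradedP AP BP bG; case/btwP: bG => GP AG GB.
rewrite dE -add1n addnA; apply: dhomogM; first apply: dhomogM.
- have gen1 S : gen S \is 1.-homog.
    rewrite /gen /ext; case: insubP => [s _ _|_]; last exact: rpred0.
    by rewrite ffunE dhomogX /= mdeg1.
  by rewrite /rel !rpredB ?rpredZ.
- by apply: IH; rewrite // -ltnS (leq_trans _ ltn) // dE !ltnS leq_addr.
- by apply: IH; rewrite // -ltnS (leq_trans _ ltn) // dE !ltnS leq_addl.
Qed.

Hypothesis flatsKL : lattice_of_flats L (set_itv P K L).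

Definition msum (a : T -> R) S : R := \sum_(i in S) a i.

Lemma rel_msum (a : T -> R) A B S : A \proper B -> A \subset S -> S \subset B ->
  rel (msum a : {set T} -> R^o) A B S = \sum_(i in S :\: A) a i
    - #|S :\: A|%:R / #|B :\: A|%:R * \sum_(i in B :\: A) a i.
Proof.
move=> AB AS SB; have dAB := card_setD_neq0 R AB.
have mD (X : {set T}) : A \subset X -> msum a X = msum a A + \sum_(i in X :\: A) a i.
  move=> AX; rewrite /msum (big_setID A) /=; congr (_ + _).
  by apply: eq_bigl => i; rewrite (setIidPr AX).
rewrite /rel (mD S) // (mD B) ?proper_sub // (card_setD_natr _ AS SB).
rewrite -!/(_ * _); rewrite /GRing.scale /=; field; exact: dAB.
Qed.

(** In degree one this is the partition of [B :\: A]. In higher degree, [Dsum_euler] and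
    [Dsum_exchange] move the modular function onto shorter intervals, where induction applies. *)
Lemma Dsum_modular (a : T -> R) A B : A \in P -> B \in P -> A \proper B ->
  K \subset A -> B \subset L -> Dsum (fun S => (msum a S)%:MP) A B = 0.
Proof.
have [n] := ubnP (pdeg P A B).
elim: n A B => // n IH A B ltn AP BP AB KA BL.
case d_eq: (pdeg P A B) => [|d]; first exact: Dsum0.
case: d d_eq => [|d] dAB.
  transitivity (\sum_(G | btw P A B G)
      (rel (msum a : {set T} -> R^o) A B G)%:MP : M).
    apply: eq_bigr => G bG; have := pdeg_btw gradedP AP BP bG.
    rewrite dAB => -[/esym/eqP]; rewrite addn_eq0 => /andP[/eqP d1 /eqP d2].
    by rewrite !q_deg0 // !mulr1 rel_mpolyC.
  rewrite -(raddf_sum (@mpolyC _ R)) /= (_ : \sum_(G | _) _ = 0) ?mpolyC0 //.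
  transitivity (\sum_(G | btw P A B G) (\sum_(i in G :\: A) a i
     - (\sum_(i in G :\: A) 1) * ((\sum_(i in B :\: A) a i) / #|B :\: A|%:R))).
    apply: eq_bigr => G /btwP[GP AG GB].
    rewrite rel_msum ?proper_sub // sumr_const.
    by rewrite mulrA mulrAC.
  rewrite sumrB -mulr_suml !(pdeg1_sum gradedP flatsKL) // sumr_const.
  by rewrite mulrC divfK ?subrr // card_setD_neq0.
have d0 : d.+1%:R != 0 :> R by rewrite pnatr_eq0.
apply: (scalerI d0); rewrite scaler0 -[d.+1]/(d.+2.-1) -dAB -Dsum_euler //.
rewrite Dsum_exchange big1 // => G bG; have dE := pdeg_btw gradedP AP BP bG.
case/btwP: bG => GP AG GB.
have KG := subset_trans KA (proper_sub AG).
have GL := subset_trans (proper_sub GB) BL.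
have lt1 : (pdeg P A G < n)%N by rewrite -ltnS (leq_trans _ ltn) // dE !ltnS leq_addr.
have lt2 : (pdeg P G B < n)%N by rewrite -ltnS (leq_trans _ ltn) // dE !ltnS leq_addl.
by rewrite !IH // mul0r mulr0 addr0 mulr0.
Qed.

(* Up to lineality, an element of the cone has positive coordinates. *)
Lemma dirD_q_pos v A B : A \in P -> B \in P -> A \proper B -> K \subset A ->
  B \subset L -> submod_cone v -> exists w : {set T} -> R,
  (forall G, btw P A B G -> 0 < w G) /\
  dirD v (q A B) = \sum_(G | btw P A B G) w G *: (q A G * q G B).
Proof.
move=> AP BP AB KA BL Cv; have sAB := proper_sub AB.
pose y := rel (ext (v : {ffun _ -> R^o})) A B.
have suby : strict_submod A B y.
  move=> S1 S2 A1 A2 B1 B2 n12 n21.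
  (* Incomparable sets avoid both endpoints [K] and [L], so the cone condition covers them. *)
  have in1 : (K \proper S1) && (S1 \proper L).
    rewrite !properE (subset_trans KA A1) (subset_trans B1 BL) /=.
    apply/andP; split.
      apply: contra n12 => S1K; apply: subset_trans A2.
      exact: subset_trans S1K KA.
    apply: contra n21 => LS1; apply: subset_trans LS1.
    exact: subset_trans B2 BL.
  have in2 : (K \proper S2) && (S2 \proper L).
    rewrite !properE (subset_trans KA A2) (subset_trans B2 BL) /=.
    apply/andP; split.
      apply: contra n21 => S2K; apply: subset_trans A1.
      exact: subset_trans S2K KA.
    apply: contra n12 => LS2; apply: subset_trans LS2.
    exact: subset_trans B1 BL.
  have := Cv (Sub S1 in1) (Sub S2 in2); rewrite !SubK => /(_ n12 n21).
  have extE S (inS : (K \proper S) && (S \proper L)) : v (Sub S inS) = ext v S.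
    by rewrite /ext (insubT (fun S => (K \proper S) && (S \proper L)) inS).
  rewrite !extE => lt12; rewrite /y /rel.
  have AI : A \subset S1 :&: S2 by rewrite subsetI A1.
  have BU : S1 :|: S2 \subset B by rewrite subUset B1.
  have AU := subset_trans A1 (subsetUl S1 S2).
  have BI := subset_trans (subsetIl S1 S2) B1.
  rewrite (card_setD_natr R A1 B1) (card_setD_natr R A2 B2).
  rewrite (card_setD_natr R AI BI) (card_setD_natr R AU BU).
  (* Cardinality is modular, so the normalization at [A] and [B] preserves strict submodularity. *)
  have cardUI : #|(S1 :|: S2) :\: A|%:R =
      #|S1 :\: A|%:R + #|S2 :\: A|%:R - #|(S1 :&: S2) :\: A|%:R :> R.
    by rewrite setDUl setDIl cardsU -setDIl natrB ?natrD //
      (leq_trans _ (leq_addr _ _)) // subset_leq_card // setSD // subsetIl.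
  rewrite cardUI /GRing.scale /=; move: lt12.
  rewrite /ext -!/(ext v _); lra.
have yA : y A = 0 by exact: (relA (ext (v : {ffun _ -> R^o})) AB).
have yB : y B = 0 by exact: (relB (ext (v : {ffun _ -> R^o})) AB).
have [a [sum_a a_lt]] := submod_strict_minorant AB suby yA yB.
have relE G : btw P A B G ->
    rel (msum a : {set T} -> R^o) A B G = \sum_(i in G :\: A) a i.
  case/btwP=> _ AG GB; rewrite rel_msum ?proper_sub //.
  by rewrite sum_a mulr0 subr0.
exists (fun G => y G - rel (msum a : {set T} -> R^o) A B G); split.
  move=> G bG; rewrite relE // subr_gt0.
  by case/btwP: bG => _ AG GB; exact: a_lt.
rewrite dirD_q // -[LHS]subr0 -[X in _ - X = _](Dsum_modular a AP BP AB KA BL) /Dsum -sumrB.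
apply: eq_bigr => G bG.
rewrite !rel_mpolyC -/y -!mulrA !mul_mpolyC.
by rewrite [RHS]scalerBl.
Qed.

Lemma dirD_qE v A B : A \in P -> B \in P -> A \proper B ->
  dirD v (q A B) = \sum_(G | btw P A B G)
     rel (ext (v : {ffun _ -> R^o})) A B G *: (q A G * q G B).
Proof.
move=> AP BP AB; rewrite dirD_q //; apply: eq_bigr => G _.
by rewrite rel_mpolyC -mulrA mul_mpolyC.
Qed.

End Derivative.
End ProjectedPolynomials.

(** * Chains of flats *)

Section Chains.
Variables (R : realFieldType) (T : finType) (P : {set {set T}}).
Variables (K L : {set T}).
Implicit Types (A B F G H S : {set T}) (s : seq {set T}).
Implicit Types (v : {ffun strictly_between K L -> R}).
Local Notation M := {mpoly R[nvars K L]}.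
Local Notation q := (q R P K L).
Hypothesis gradedP : forall A B, A \in P -> B \in P -> A \subset B ->
  graded (set_itv P A B).
Hypothesis flatsKL : lattice_of_flats L (set_itv P K L).

(* A chain of flats is given by its least element [A] and the list [s] of the  *)
(* other ones; [pch A s] is the product of [q] over its gaps.                  *)
Fixpoint chain A s : bool :=
  if s is B :: s' then [&& B \in P, A \proper B, B \subset L & chain B s']
  else true.

Fixpoint pch A s : M := if s is B :: s' then q A B * pch B s' else 1.

Fixpoint cdeg A s : nat :=
  if s is B :: s' then (pdeg P A B + cdeg B s')%N else 0%N.

Fixpoint compat A s G : bool :=
  if s is B :: s' then btw P A B G || compat B s' G else false.

(** Meaningful for [G] compatible with the chain; the empty list is a default value, as is 0 in
    [wt]. *)
Fixpoint ins s G : seq {set T} :=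
  if s is B :: s' then if G \proper B then [:: G, B & s'] else B :: ins s' G
  else [::].

Fixpoint wt A s v G : R :=
  if s is B :: s' then
    if G \proper B then rel (ext (v : {ffun _ -> R^o})) A B G else wt B s' v G
  else 0.

Lemma compat_proper A s G : chain A s -> compat A s G ->
  [/\ A \proper G, G \proper L & G \in P].
Proof.
elim: s A => //= B s IH A /and4P[BP AB BL cB] /orP[/btwP[GP AG GB]|/(IH _ cB)].
  by split=> //; exact: proper_sub_trans GB BL.
by case=> BG GL GP; split=> //; exact: proper_trans BG.
Qed.

Lemma compat_notin A s G : chain A s -> compat A s G -> G \notin A :: s.
Proof.
elim: s A => //= B s IH A /and4P[BP AB BL cB] /orP[/btwP[GP AG GB]|].
  have [ | nG] := boolP (G \in B :: s); last first.
    by rewrite inE negb_or nG andbT; apply: contraTneq AG => ->; rewrite properxx.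
  suff : {in B :: s, forall F, B \subset F}.
    by move=> h /h BG; move: GB; rewrite properE BG andbF.
  move: cB; clear -GB; elim: s B GB => [|C s IH] B GB /=.
    by move=> _ F; rewrite inE => /eqP->.
  case/and4P=> _ BC _ cC F; rewrite inE => /orP[/eqP->//|FC].
  apply: subset_trans (proper_sub BC) (IH C _ cC _ FC).
  exact: proper_trans GB BC.
move=> cG; have [BG _ _] := compat_proper cB cG.
rewrite inE negb_or IH // andbT; apply: contraTneq BG => ->.
by rewrite properE (proper_sub AB) andbF.
Qed.

Lemma compat_cons A B s G : chain B s -> A \proper B ->
  (compat A (B :: s) G && (G \proper B) = btw P A B G) *
  (compat A (B :: s) G && ~~ (G \proper B) = compat B s G).
Proof.
move=> cB AB; split=> /=.
  have [bG|_] := boolP (btw P A B G); first by case/btwP: bG.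
  apply/negP => /andP[/= cG GB]; have [BG _ _] := compat_proper cB cG.
  by move: GB; rewrite properE (proper_sub BG) andbF.
have [cG|_] := boolP (compat B s G).
  have [BG _ _] := compat_proper cB cG.
  by rewrite orbT properE (proper_sub BG) andbF.
by rewrite orbF; apply/negP => /andP[/btwP[_ _ ->]].
Qed.

Lemma sum_compat_cons (V : nmodType) A B s (F : {set T} -> V) :
  chain B s -> A \proper B ->
  \sum_(G | compat A (B :: s) G) F G =
  \sum_(G | btw P A B G) F G + \sum_(G | compat B s G) F G.
Proof.
move=> cB AB; rewrite (bigID (fun G => G \proper B)) /=.
by congr (_ + _); apply: eq_bigl => G; rewrite (compat_cons G cB AB).
Qed.

(** The weights are left free so that the same Leibniz step serves the actual coordinates [wt] and
    their positive replacements. *)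
Lemma dirD_pch_cons v A B s (w1 w2 : {set T} -> R) : chain B s -> A \proper B ->
  dirD v (q A B) = \sum_(G | btw P A B G) w1 G *: (q A G * q G B) ->
  dirD v (pch B s) = \sum_(G | compat B s G) w2 G *: pch B (ins s G) ->
  dirD v (pch A (B :: s)) = \sum_(G | compat A (B :: s) G)
     (if G \proper B then w1 G else w2 G) *: pch A (ins (B :: s) G).
Proof.
move=> cB AB D1 D2; rewrite sum_compat_cons // dirDM D1 D2; congr (_ + _).
  rewrite mulr_suml; apply: eq_bigr => G /btwP[_ _ /= ->] /=.
  by rewrite -scalerAl mulrA.
rewrite mulr_sumr; apply: eq_bigr => G cG.
have [BG _ _] := compat_proper cB cG.
by rewrite /= properE (proper_sub BG) andbF /= -scalerAr.
Qed.

Lemma dirD_pch v A s : A \in P -> chain A s ->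
  dirD v (pch A s) = \sum_(G | compat A s G) wt A s v G *: pch A (ins s G).
Proof.
elim: s A => [|B s IH] A AP /=; first by rewrite dirD1 big_pred0.
case/and4P=> BP AB BL cB; rewrite -/(pch A (B :: s)).
exact: (dirD_pch_cons cB AB (dirD_qE gradedP v AP BP AB) (IH B BP cB)).
Qed.

(** Each gap receives its own modular correction, so the weights are positive in all gaps at
    once. *)
Lemma dirD_pch_pos v A s : submod_cone v -> A \in P -> K \subset A ->
  chain A s -> exists w : {set T} -> R, (forall G, compat A s G -> 0 < w G) /\
    dirD v (pch A s) = \sum_(G | compat A s G) w G *: pch A (ins s G).
Proof.
move=> Cv; elim: s A => [|B s IH] A AP KA.
  by exists (fun=> 0); split=> //=; rewrite dirD1 big_pred0.
move=> /= /and4P[BP AB BL cB].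
have [w1 [w1_gt0 D1]] := dirD_q_pos gradedP flatsKL AP BP AB KA BL Cv.
have [w2 [w2_gt0 D2]] := IH B BP (subset_trans KA (proper_sub AB)) cB.
exists (fun G => if G \proper B then w1 G else w2 G); split=> [G|].
  have [e1 e2] := compat_cons G cB AB; move: e1 e2 => /=.
  case: (G \proper B); rewrite ?andbT ?andbF.
    by move=> -> _; exact: w1_gt0.
  by move=> _ ->; exact: w2_gt0.
exact: dirD_pch_cons.
Qed.

Lemma chain_ins A s G : chain A s -> compat A s G -> chain A (ins s G).
Proof.
elim: s A => //= B s IH A /and4P[BP AB BL cB] /orP[/btwP[GP AG GB]|cG].
  by rewrite GB /= GP AG GB BP BL cB (subset_trans (proper_sub GB) BL).
have [BG _ _] := compat_proper cB cG.
by rewrite properE (proper_sub BG) andbF /= BP AB BL IH.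
Qed.

Lemma cdeg_ins A s G : A \in P -> chain A s -> compat A s G ->
  cdeg A s = (cdeg A (ins s G)).+1.
Proof.
elim: s A => //= B s IH A AP /and4P[BP AB BL cB] /orP[bG|cG].
  rewrite (pdeg_btw gradedP AP BP bG); case/btwP: bG => _ _ -> /=.
  by rewrite addSn addnA.
have [BG _ _] := compat_proper cB cG.
by rewrite properE (proper_sub BG) andbF /= (IH B BP cB cG) addnS.
Qed.

Lemma pch_deg0 A s : cdeg A s = 0%N -> pch A s = 1.
Proof.
elim: s A => //= B s IH A /eqP; rewrite addn_eq0 => /andP[/eqP d0 /eqP/IH->].
by rewrite mulr1 q_deg0.
Qed.

Lemma compat_ex A s : A \in P -> chain A s -> (0 < cdeg A s)%N ->
  exists G, compat A s G.
Proof.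
elim: s A => //= B s IH A AP /and4P[BP AB BL cB]; rewrite addn_gt0.
case/orP=> [/(pdeg_gt0 gradedP AP BP AB)|/(IH B BP cB)] [G bG]; exists G.
  by rewrite bG.
by rewrite bG orbT.
Qed.

Lemma compat_ins A s G H : chain A s -> compat A s G -> compat A s H ->
  (G \proper H) || (H \proper G) -> compat A (ins s G) H.
Proof.
elim: s A => //= B s IH A /and4P[BP AB BL cB].
case/orP=> [/btwP[GP AG GB]|cG]; case/orP=> [/btwP[HP AH HB]|cH].
- by rewrite GB /= /btw HP AH HB /= => /orP[->|->]; rewrite /= ?orbT ?andbT.
- by rewrite GB /= cH !orbT.
- have [BG _ _] := compat_proper cB cG.
  by rewrite [G \proper B]properE (proper_sub BG) andbF /= /btw HP AH HB.
- have [BG _ _] := compat_proper cB cG.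
  rewrite [G \proper B]properE (proper_sub BG) andbF /= => cmp.
  by rewrite (IH B cB cG cH cmp) orbT.
Qed.

(** Flats in different gaps are always comparable. Only when a single gap has positive degree is
    connectivity inside an interval needed. *)
Lemma compat_connected (V : Type) A s (f : {set T} -> V) :
  A \in P -> K \subset A -> chain A s -> (1 < cdeg A s)%N ->
  (forall G H, compat A s G -> compat A s H -> G \proper H -> f G = f H) ->
  forall G H, compat A s G -> compat A s H -> f G = f H.
Proof.
elim: s A => //= B s IH A AP KA /and4P[BP AB BL cB] d_gt1 fcmp.
have KB := subset_trans KA (proper_sub AB).
have lower G H : btw P A B G -> compat B s H -> f G = f H.
  move=> bG cH; apply: fcmp; rewrite ?bG ?cH ?orbT //.
  have [BH _ _] := compat_proper cB cH; case/btwP: bG => _ _ GB.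
  exact: proper_trans BH.
have [d1|d1] := leqP (pdeg P A B) 0.
  have no G : ~~ btw P A B G.
    by apply/negP => /(btw_pdeg_gt0 gradedP AP BP); rewrite ltnNge d1.
  move=> G H; rewrite (negPf (no G)) (negPf (no H)) /=; apply: IH => //.
    by move: d1 d_gt1; rewrite leqn0 => /eqP->.
  by move=> G' H' cG cH; apply: fcmp; rewrite ?cG ?cH orbT.
have [d2|d2] := leqP (cdeg B s) 0.
  have no G : ~~ compat B s G.
    by apply/negP => /(cdeg_ins BP cB) E; rewrite E in d2.
  move=> G H; rewrite (negPf (no G)) (negPf (no H)) !orbF.
  apply: (btw_connected gradedP flatsKL) => //.
    by move: d2 d_gt1; rewrite leqn0 => /eqP->; rewrite addn0.
  by move=> G' H' bG bH; apply: fcmp; rewrite ?bG ?bH.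
have [G0 bG0] := pdeg_gt0 gradedP AP BP AB d1.
have [H0 cH0] := compat_ex BP cB d2.
have toH0 G : btw P A B G || compat B s G -> f G = f H0.
  case/orP=> [bG|cG]; first exact: lower.
  by rewrite -(lower G0 G) // (lower G0 H0).
by move=> G H /toH0-> /toH0->.
Qed.

Lemma pch_homog A s : A \in P -> chain A s -> pch A s \is (cdeg A s).-homog.
Proof.
elim: s A => [|B s IH] A AP /=; first by rewrite dhomog1.
by case/and4P=> BP AB BL cB; apply: dhomogM; [exact: q_homog | exact: IH].
Qed.

Definition ptv G : {ffun strictly_between K L -> R} :=
  [ffun S => (val S == G)%:R].

Lemma ext_ptv G S : K \proper G -> G \proper L ->
  ext (ptv G : {ffun _ -> R^o}) S = (S == G)%:R.
Proof.
move=> KG GL; rewrite /ext; case: insubP => [s _ <-|]; first by rewrite ffunE.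
by case: eqP => // ->; rewrite KG GL.
Qed.

(** Since [H] is not in the chain, the coordinate vector vanishes at the ends of every gap and
    projecting it brings no correction. *)
Lemma wt_ptv A s G H : K \proper H -> H \proper L -> chain A s ->
  H \notin A :: s -> compat A s G -> wt A s (ptv H) G = (G == H)%:R.
Proof.
move=> KH HL; elim: s A => //= B s IH A /and4P[BP AB BL cB].
rewrite inE negb_or => /andP[HA HB] cG.
have [e1 e2] := compat_cons G cB AB; move: e1 e2; rewrite /= cG /=.
case: ifP => /= GB e1 e2; last by apply: IH; rewrite // -e2.
move: HB; rewrite inE negb_or => /andP[HB _].
rewrite /rel !ext_ptv //; rewrite [A == H]eq_sym [B == H]eq_sym.
by rewrite (negPf HA) (negPf HB) !scaler0 !subr0.
Qed.

Lemma dirD_ptv_pch A s H : A \in P -> K \proper H -> H \proper L -> chain A s ->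
  H \notin A :: s ->
  dirD (ptv H) (pch A s) = if compat A s H then pch A (ins s H) else 0.
Proof.
move=> AP KH HL cs HA; rewrite dirD_pch // big_mkcond /= (bigD1 H) //=.
rewrite big1 => [|G GH].
  by rewrite addr0; case: ifP => // cH; rewrite wt_ptv // eqxx scale1r.
by case: ifP => // cG; rewrite wt_ptv // (negPf GH) scale0r.
Qed.

End Chains.

(** * Hyperbolic forms *)

Section IteratedDerivatives.
Variables (R : rcfType) (I : finType).
Implicit Types (u v x y : {ffun I -> R}) (vs : seq {ffun I -> R}).
Implicit Types (p g : {mpoly R[#|I|]}).

Lemma dirDs_is_linear vs : linear (@dirDs R I vs).
Proof. by elim: vs => [|v vs IH] c p p' //=; rewrite IH linearP. Qed.

HB.instance Definition _ vs :=
  GRing.isLinear.Build R {mpoly R[#|I|]} {mpoly R[#|I|]} _ (@dirDs R I vs)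
    (dirDs_is_linear vs).

Lemma dirDs_dirD v vs p : dirDs vs (dirD v p) = dirD v (dirDs vs p).
Proof. by elim: vs => //= w vs ->; rewrite dirD_comm. Qed.

Definition ev vs p : R := (dirDs vs p)@_0%MM.

Lemma ev_is_linear vs : linear (ev vs : {mpoly R[#|I|]} -> R^o).
Proof. by move=> c p p'; rewrite /ev linearP mcoeffD mcoeffZ. Qed.

HB.instance Definition _ vs :=
  GRing.isLinear.Build R {mpoly R[#|I|]} R^o _ (ev vs) (ev_is_linear vs).

Lemma ev_cons v vs p : ev (v :: vs) p = ev vs (dirD v p).
Proof. by rewrite /ev /= dirDs_dirD. Qed.

Lemma dirD_sum_dir p n (c : 'I_n -> R) (e : 'I_n -> {ffun I -> R}) :
  dirD [ffun i => \sum_k c k * e k i] p = \sum_k c k *: dirD (e k) p.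
Proof.
transitivity (\sum_i \sum_k (c k * e k i) *: p^`M(enum_rank i)).
  by apply: eq_bigr => i _; rewrite ffunE scaler_suml.
rewrite exchange_big /=; apply: eq_bigr => k _.
by rewrite /dirD scaler_sumr; apply: eq_bigr => i _; rewrite scalerA.
Qed.

Lemma dirD_sum v n (F : 'I_n -> {mpoly R[#|I|]}) :
  dirD v (\sum_k F k) = \sum_k dirD v (F k).
Proof. exact: linear_sum. Qed.

Lemma dirD_dir_sub p (a b : R) x y :
  dirD [ffun i => a * x i - b * y i] p = a *: dirD x p - b *: dirD y p.
Proof.
rewrite /dirD !scaler_sumr -sumrB; apply: eq_bigr => i _.
by rewrite !ffunE scalerBl !scalerA.
Qed.

(* The form [x, y |-> D_x D_y D_vs p] is nonpositive on a hyperplane, given as *)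
(* the kernel of [x |-> D_x g].                                               *)
Definition hyperbolic vs p : Prop := exists g, forall x,
  (dirD x g)@_0%MM = 0 -> ev vs (dirD x (dirD x p)) <= 0.

(** Positivity at [b] puts [b] off the hyperplane, so [z], the multiple of [x] corrected along [b],
    can be taken in it. Expanding the form at [z] gives the inequality up to a square. *)
Lemma hyperbolic_reverse_CS vs p x b : hyperbolic vs p ->
  0 < ev vs (dirD b (dirD b p)) ->
  ev vs (dirD x (dirD x p)) * ev vs (dirD b (dirD b p)) <=
  ev vs (dirD x (dirD b p)) ^+ 2.
Proof.
move=> [g hg] bb_gt0; pose l y := (dirD y g)@_0%MM.
have lb0 : l b != 0.
  by apply: contraTneq bb_gt0 => lb0; rewrite -leNgt hg.
pose z := [ffun i => l b * x i - l x * b i].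
have : ev vs (dirD z (dirD z p)) <= 0.
  apply: hg; rewrite dirD_dir_sub mcoeffB !mcoeffZ -!/(l _); ring.
have -> : ev vs (dirD z (dirD z p)) = l b ^+ 2 * ev vs (dirD x (dirD x p))
    - 2 * (l b * l x) * ev vs (dirD x (dirD b p))
    + l x ^+ 2 * ev vs (dirD b (dirD b p)).
  rewrite !dirD_dir_sub !linearB !linearZ /= [dirD b (dirD x p)]dirD_comm.
  by rewrite /GRing.scale /=; ring.
set xx := ev vs (dirD x (dirD x p)); set xb := ev vs (dirD x (dirD b p)).
set bb := ev vs (dirD b (dirD b p)) in bb_gt0 *.
move=> zz; have lb2 : 0 < l b ^+ 2 by rewrite exprn_even_gt0.
rewrite -(ler_pM2l lb2) -subr_ge0.
have -> : l b ^+ 2 * xb ^+ 2 - l b ^+ 2 * (xx * bb) =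
  (l b * xb - l x * bb) ^+ 2
  + (- (l b ^+ 2 * xx - 2 * (l b * l x) * xb + l x ^+ 2 * bb)) * bb by ring.
by rewrite addr_ge0 ?sqr_ge0 // mulr_ge0 ?oppr_ge0 // ltW.
Qed.

End IteratedDerivatives.

(** * Positivity and the Bochner step for products over chains *)

Section ChainLorentzian.
Variables (R : rcfType) (T : finType) (P : {set {set T}}).
Variables (K L : {set T}).
Implicit Types (A B F G H S : {set T}) (s : seq {set T}).
Implicit Types (x v b : {ffun strictly_between K L -> R}).
Implicit Types (vs : seq {ffun strictly_between K L -> R}).
Local Notation M := {mpoly R[nvars K L]}.
Local Notation pch := (pch R P K L).
Hypothesis gradedP : forall A B, A \in P -> B \in P -> A \subset B ->
  graded (set_itv P A B).
Hypothesis flatsKL : lattice_of_flats L (set_itv P K L).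

Lemma pch_ev_gt0 vs A s : (forall v, v \in vs -> submod_cone v) ->
  A \in P -> K \subset A -> chain P L A s -> size vs = cdeg P A s ->
  0 < ev vs (pch A s).
Proof.
move=> + AP KA; elim: vs s => [|v vs IH] s Cvs cs szs.
  by rewrite pch_deg0 // /ev /= mcoeff1 eqxx ltr01.
have Cv : submod_cone v by apply: Cvs; rewrite mem_head.
have [w [w_gt0 Dw]] := dirD_pch_pos gradedP flatsKL Cv AP KA cs.
rewrite ev_cons Dw linear_sum /=.
have [|G cG] := compat_ex gradedP AP cs; first by rewrite -szs.
have term_gt0 H : compat P A s H -> 0 < ev vs (w H *: pch A (ins s H)).
  move=> cH; rewrite linearZ /= mulr_gt0 ?w_gt0 //; apply: IH.
  - by move=> u uvs; apply: Cvs; rewrite inE uvs orbT.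
  - exact: chain_ins.
  - by apply: succn_inj; rewrite -(cdeg_ins gradedP AP cs cH) -szs.
rewrite (bigD1 G) //=; apply: ltr_wpDr; last exact: term_gt0.
by apply: sumr_ge0 => H /andP[cH _]; apply/ltW/term_gt0.
Qed.

(** Write [D_b p] as the sum of [v k * pk k] with positive [v]. The Hessian [H] of [p] in the flat
    directions has [(H v)_k = D_b D_b (pk k)] and [(H x)_k = D_x D_b (pk k)], while its form is the
    sum of [v k * D_x D_x (pk k)], all after applying [vs]. Reverse Cauchy-Schwarz for each [pk k]
    is then the inequality of [perron_bochner]. *)
Lemma hyperbolic_bochner b vs A s : (forall v, v \in b :: vs -> submod_cone v) ->
  A \in P -> K \subset A -> chain P L A s -> cdeg P A s = (size vs).+3 ->
  (forall G, compat P A s G -> hyperbolic vs (pch A (ins s G))) ->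
  hyperbolic (b :: vs) (pch A s).
Proof.
move=> Cvs AP KA cs deg hyp; set p := pch A s.
have Cb : submod_cone b by apply: Cvs; rewrite mem_head.
have [w [w_gt0 Dw]] := dirD_pch_pos gradedP flatsKL Cb AP KA cs.
pose I := [set G | compat P A s G]; pose N := #|I|.
pose g (k : 'I_N) := enum_val k : {set T}.
have cg k : compat P A s (g k) by have := enum_valP k; rewrite inE.
have KG G : compat P A s G -> K \proper G.
  by case/(compat_proper cs) => AG _ _; exact: sub_proper_trans AG.
have GL G : compat P A s G -> G \proper L by case/(compat_proper cs).
pose e k := ptv R K L (g k).
have sumI (F : {set T} -> M) : \sum_(G | compat P A s G) F G = \sum_k F (g k).
  transitivity (\sum_(G in I) F G); first by apply: eq_bigl => G; rewrite inE.
  exact: big_enum_val.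
pose pk k := pch A (ins s (g k)).
have De k : dirD (e k) p = pk k.
  rewrite dirD_ptv_pch ?KG ?GL ?cg //; exact: (compat_notin cs (cg k)).
have Db : dirD b p = \sum_k w (g k) *: pk k by rewrite Dw sumI.
have Dx x : dirD x p = \sum_k wt A s x (g k) *: pk k by rewrite dirD_pch // sumI.
have ck k : chain P L A (ins s (g k)) by apply: chain_ins.
have dk k : cdeg P A (ins s (g k)) = (size vs).+2.
  by apply: succn_inj; rewrite -(cdeg_ins gradedP AP cs (cg k)).
pose H : 'M[R]_N := \matrix_(k, l) ev (b :: vs) (dirD (e k) (dirD (e l) p)).
have symH : H^T = H by apply/matrixP => k l; rewrite !mxE dirD_comm.
have HE k (c : 'I_N -> R) :
    \sum_l H k l * c l = ev (b :: vs) (dirD (e k) (\sum_l c l *: pk l)).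
  rewrite dirD_sum /= (linear_sum (ev _)) /=; apply: eq_bigr => l _.
  by rewrite !linearZ /= mxE De mulrC.
pose v k := w (g k).
have Hv k : \sum_l H k l * v l = ev vs (dirD b (dirD b (pk k))).
  by rewrite HE -Db ev_cons [dirD (e k) _]dirD_comm De.
have Hv_gt0 k : 0 < \sum_l H k l * v l.
  rewrite Hv -!ev_cons; apply: pch_ev_gt0 => //.
  by move=> u; rewrite inE => /orP[/eqP->//|]; exact: Cvs.
(* A mixed derivative inserts both flats, and vanishes when the second does not fit the refined
   chain. *)
have offdiag k l : k != l -> ev (b :: vs) (dirD (e k) (dirD (e l) p)) =
    if compat P A (ins s (g l)) (g k)
    then ev (b :: vs) (pch A (ins (ins s (g l)) (g k))) else 0.
  move=> kl; rewrite De dirD_ptv_pch ?KG ?GL ?cg //.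
    by case: ifP; rewrite ?linear0.
  have : g k \notin A :: s by apply: (compat_notin cs (cg k)).
  rewrite !inE !negb_or => /andP[-> gks] /=.
  have gkl : g k != g l by rewrite (inj_eq enum_val_inj).
  elim: (s) gks => //= B s' IH; rewrite inE negb_or => /andP[nB ns'].
  by case: ifP => _; rewrite !inE !negb_or ?gkl ?nB ?ns' ?IH.
have ev2_gt0 k l : compat P A (ins s (g l)) (g k) ->
    0 < ev (b :: vs) (pch A (ins (ins s (g l)) (g k))).
  move=> ckl; apply: pch_ev_gt0 => //; first exact: chain_ins.
  by apply: succn_inj; rewrite -(cdeg_ins gradedP AP (ck l) ckl) dk.
have H_ge0 k l : k != l -> 0 <= H k l.
  by move=> kl; rewrite mxE offdiag //; case: ifP => // /ev2_gt0/ltW.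
have conn (f : 'I_N -> R) :
    (forall k l, k != l -> 0 < H k l -> f k = f l) -> forall k l, f k = f l.
  move=> fH k l; pose gk := enum_valP k.
  pose fS G := f (enum_rank_in gk G).
  have fSE m : fS (g m) = f m by rewrite /fS enum_valK_in.
  rewrite -(fSE k) -(fSE l).
  apply: (compat_connected gradedP flatsKL AP KA cs _ _ (cg k) (cg l)).
    by rewrite deg.
  move=> G G' cG cG' GG'.
  have GI : G \in I by rewrite inE.
  have GI' : G' \in I by rewrite inE.
  have gE F : F \in I -> g (enum_rank_in gk F) = F.
    by move=> FI; rewrite /g enum_rankK_in.
  have ne : enum_rank_in gk G != enum_rank_in gk G'.
    apply: contraTneq GG' => E.
    by rewrite -(gE G) // E gE // properxx.
  apply: fH => //; rewrite mxE offdiag // !gE //.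
  have cc : compat P A (ins s G') G by apply: (compat_ins cs cG' cG); rewrite GG' orbT.
  rewrite cc; have := @ev2_gt0 (enum_rank_in gk G) (enum_rank_in gk G').
  by rewrite !gE //; apply.
pose X (c : 'I_N -> R) := [ffun i => \sum_k c k * e k i].
have DX c : dirD (X c) p = \sum_k c k *: pk k.
  by rewrite dirD_sum_dir; apply: eq_bigr => k _; rewrite De.
have qH c : qform H c = ev (b :: vs) (dirD (X c) (dirD (X c) p)).
  rewrite [dirD (X c) (dirD _ _)]dirD_sum_dir (linear_sum (ev _)) /=.
  by apply: eq_bigr => k _; rewrite HE -DX linearZ.
have boch c : qform H c <=
    \sum_k v k * (\sum_l H k l * c l) ^+ 2 / (\sum_l H k l * v l).
  rewrite qH ev_cons 2!(dirD_comm b) Db dirD_sum /=.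
  rewrite dirD_sum /= (linear_sum (ev _)) /=.
  apply: ler_sum => k _; rewrite !linearZ /= -mulrA ler_pM2l ?w_gt0 //.
  rewrite ler_pdivlMr // Hv HE -DX ev_cons.
  rewrite [dirD (e k) _]dirD_comm De [dirD b (dirD (X c) _)]dirD_comm.
  by apply: hyperbolic_reverse_CS; [exact: hyp | rewrite -Hv].
have pb := perron_bochner symH (fun k => w_gt0 _ (cg k)) Hv_gt0 H_ge0 conn boch.
(* The derivative of this form along [x] is the pairing of [H v] with the coordinates of [x].
   Replacing [x] by those coordinates changes no derivative of [p]. *)
exists (dirDs (b :: vs) (dirD b p)) => x lx0.
have <- : qform H (fun k => wt A s x (g k)) =
    ev (b :: vs) (dirD x (dirD x p)).
  have DxX : dirD x p = dirD (X (fun k => wt A s x (g k))) p by rewrite Dx DX.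
  by rewrite qH DxX dirD_comm -DxX dirD_comm.
apply: pb; rewrite -[RHS]lx0 -dirDs_dirD -/(ev _ _) dirD_comm Dx.
rewrite dirD_sum /= (linear_sum (ev _)) /=; apply: eq_bigr => k _.
by rewrite !linearZ /= Hv ev_cons mulrC.
Qed.

End ChainLorentzian.

(** * Degree two and the induction on the degree *)

Section RankThree.
Variables (R : rcfType) (T : finType) (P : {set {set T}}).
Variables (K L : {set T}).
Implicit Types (A B F G H S : {set T}) (s : seq {set T}).
Implicit Types (x v b : {ffun strictly_between K L -> R}).
Local Notation q := (q R P K L).
Local Notation pch := (pch R P K L).
Hypothesis gradedP : forall A B, A \in P -> B \in P -> A \subset B ->
  graded (set_itv P A B).
Hypothesis flatsKL : lattice_of_flats L (set_itv P K L).

Lemma pdeg1_sum_card A B : A \in P -> B \in P -> K \subset A -> A \proper B ->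
  B \subset L -> pdeg P A B = 1%N ->
  \sum_(G | btw P A B G) #|G :\: A|%:R = #|B :\: A|%:R :> R.
Proof.
move=> AP BP KA AB BL d1; rewrite -sumr_const -(pdeg1_sum gradedP flatsKL) //.
by apply: eq_bigr => G _; rewrite sumr_const.
Qed.

Lemma pdeg1_btw A B G : A \in P -> B \in P -> pdeg P A B = 1%N ->
  btw P A B G -> pdeg P A G = 0%N /\ pdeg P G B = 0%N.
Proof.
move=> AP BP d1 bG; have := pdeg_btw gradedP AP BP bG; rewrite d1 => -[/esym/eqP].
by rewrite addn_eq0 => /andP[/eqP -> /eqP ->].
Qed.

Lemma dirD_q_deg1 x A B : A \in P -> B \in P -> A \proper B -> pdeg P A B = 1%N ->
  dirD x (q A B) =
  (\sum_(G | btw P A B G) rel (ext (x : {ffun _ -> R^o})) A B G)%:MP.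
Proof.
move=> AP BP AB d1; rewrite (dirD_qE gradedP) // (raddf_sum (@mpolyC _ R)) /=.
apply: eq_bigr => G bG; have [dA dB] := pdeg1_btw AP BP d1 bG.
by rewrite !q_deg0 // mulr1 alg_mpolyC.
Qed.

(* With [w] the coordinates of [x] relative to [A] and [B], the form equals    *)
(* [(\sum_(H atom) w H) ^+ 2 - \sum_(F coatom) (w F - \sum_(H < F) w H) ^+ 2]. *)
Lemma q_deg2_hyperbolic A B : A \in P -> B \in P -> A \proper B ->
  K \subset A -> B \subset L -> pdeg P A B = 2%N -> hyperbolic [::] (q A B).
Proof.
move=> AP BP AB KA BL d2.
pose at_ H := btw P A B H && (pdeg P A H == 0%N).
pose co F := btw P A B F && (pdeg P F B == 0%N).
have d_btw G : btw P A B G -> (pdeg P A G + pdeg P G B = 1)%N.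
  by move=> /(pdeg_btw gradedP AP BP); rewrite d2 => -[].
have coE G : btw P A B G -> (pdeg P G B == 0%N) = ~~ (pdeg P A G == 0%N).
  by move=> /d_btw; case: (pdeg P A G) => [|[|n]]; case: (pdeg P G B) => [|[|m]].
have atP H : at_ H -> [/\ H \in P, A \proper H, H \proper B, pdeg P A H = 0%N
    & pdeg P H B = 1%N].
  case/andP=> /[dup] bH /btwP[HP AH HB] /eqP d0; split=> //.
  by have := d_btw _ bH; rewrite d0.
have coP F : co F -> [/\ F \in P, A \proper F, F \proper B, pdeg P A F = 1%N
    & pdeg P F B = 0%N].
  case/andP=> /[dup] bF /btwP[FP AF FB] /eqP d0; split=> //.
  by have := d_btw _ bF; rewrite d0 addn0.
pose N H F : R := (H \proper F)%:R.
have sum_above H (f : {set T} -> R) : at_ H ->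
    \sum_(F | btw P H B F) f F = \sum_(F | co F) N H F * f F.
  move=> /atP[HP AH HB dH dB]; rewrite big_mkcond [RHS]big_mkcond /=.
  apply: eq_bigr => F _; case: ifP => [/[dup] bF /btwP[FP HF FB]|nbF].
    have [_ dF] := pdeg1_btw HP BP dB bF.
    by rewrite /co /btw FP FB (proper_trans AH HF) dF /N HF mul1r.
  case: ifP => // /coP[FP AF FB _ _]; rewrite /N.
  by move: nbF; rewrite /btw FP FB andbT /= => ->; rewrite mul0r.
have sum_below F (f : {set T} -> R) : co F ->
    \sum_(H | btw P A F H) f H = \sum_(H | at_ H) N H F * f H.
  move=> /coP[FP AF FB dF dB]; rewrite big_mkcond [RHS]big_mkcond /=.
  apply: eq_bigr => H _; case: ifP => [/[dup] bH /btwP[HP AH HF]|nbH].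
    have [dH _] := pdeg1_btw AP FP dF bH.
    by rewrite /at_ /btw HP AH (proper_trans HF FB) dH /N HF mul1r.
  case: ifP => // /atP[HP AH HB _ _]; rewrite /N.
  by move: nbH; rewrite /btw HP AH /= => ->; rewrite mul0r.
pose m H := \sum_(F | co F) N H F.
(* Two distinct atoms lie below exactly one coatom, their join. *)
have common H H' : at_ H -> at_ H' ->
    \sum_(F | co F) N H F * N H' F = 1 + (H == H')%:R * (m H - 1).
  move=> aH aH'; have [<-|neH] := eqVneq H H'.
    rewrite mul1r addrC subrK; apply: eq_bigr => F _.
    by rewrite /N; case: (H \proper F); rewrite ?mulr1 ?mulr0.
  have [HP AH HB dH dHB] := atP _ aH; have [HP' AH' HB' dH' _] := atP _ aH'.
  have [i iH' iH] : exists2 i, i \in H' & i \notin H.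
    apply/subsetPn; apply: contra neH => sH'.
    by rewrite (pdeg0_eq gradedP AP HP dH HP' AH' sH').
  have iB : i \in B by apply: (subsetP (proper_sub HB')).
  have iA : i \notin A by apply: contra iH; exact: (subsetP (proper_sub AH)).
  have KH := subset_trans KA (proper_sub AH).
  have [c bc uc] := pdeg1_btw_uniq gradedP flatsKL HP BP KH HB BL dHB iB iH.
  have [_ dc] := pdeg1_btw HP BP dHB bc.
  have [cP Hc cB] := btwP _ _ _ _ bc.
  have cc : co c by rewrite /co /btw cP cB (proper_trans AH Hc) dc.
  have [_ _ _ dAc _] := coP _ cc.
  have ic : i \in c by rewrite uc.
  have H'c : H' \proper c.
    rewrite properEneq (cover_sub gradedP flatsKL AP cP HP' KA _ _ AH' _ dH' iH' ic iA);
      rewrite ?andbT ?(subset_trans (proper_sub cB) BL)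
        ?(subset_trans (proper_sub HB') BL) ?(proper_sub (proper_trans AH Hc)) //.
    by apply/eqP => E; rewrite E dAc in dH'.
  rewrite mul0r addr0 (bigD1 c) //= {1 2}/N Hc H'c mulr1 big1 ?addr0 //.
  move=> F /andP[/coP[FP AF FB _ _] Fc]; rewrite /N.
  have [HF|] := boolP (H \proper F); last by rewrite mul0r.
  have [H'F|] := boolP (H' \proper F); last by rewrite mulr0.
  have bF : btw P H B F by apply/btwP.
  by move: Fc; rewrite -(uc F bF) (subsetP (proper_sub H'F)).
exists (\sum_(H | at_ H) rel (gen R K L) A B H) => x.
pose w := rel (ext (x : {ffun _ -> R^o})) A B.
have -> : (dirD x (\sum_(H | at_ H) rel (gen R K L) A B H))@_0%MM =
    \sum_(H | at_ H) w H.
  rewrite (linear_sum (dirD x)) /= (raddf_sum (mcoeff _)) /=.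
  apply: eq_bigr => H _.
  by rewrite dirD_rel_gen rel_mpolyC mcoeffC eqxx mulr1.
move=> w0; rewrite /ev /= (dirD_qE gradedP x AP BP AB) (linear_sum (dirD x)) /=.
rewrite (raddf_sum (mcoeff _)) /= (bigID (fun G => pdeg P A G == 0%N)) /=.
rewrite -/at_ [X in _ + X](eq_bigl co); last first.
  by move=> G; rewrite /co; case: (boolP (btw P A B G)) => //= /coE.
pose s F := \sum_(H | at_ H) N H F * w H.
rewrite (eq_bigr (fun H => w H * ((\sum_(F | co F) N H F * w F)
                                   - (m H - 1) * w H))); last first.
  move=> H aH; have [HP AH HB dH dB] := atP H aH.
  rewrite linearZ /= mcoeffZ; congr (_ * _).
  rewrite (q_deg0 _ _ _ dH) mul1r dirD_q_deg1 // mcoeffC eqxx mulr1.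
  have KH := subset_trans KA (proper_sub AH).
  (* The projection to [[H, B]] subtracts these fractions of [w H]; each is 1 minus a fraction
     [#|F :\: H| / #|B :\: H|], and the latter add up to 1. *)
  have -> : m H - 1 = \sum_(F | btw P H B F) #|B :\: F|%:R / #|B :\: H|%:R.
    have one : \sum_(F | btw P H B F) #|F :\: H|%:R / #|B :\: H|%:R = 1 :> R.
      by rewrite -mulr_suml pdeg1_sum_card // divff // card_setD_neq0.
    rewrite -[in LHS]one /m (eq_bigr (fun F => N H F * 1)); last first.
      by move=> F _; rewrite mulr1.
    rewrite -(sum_above H (fun=> 1)) // -sumrB.
    apply: eq_bigr => F /btwP[FP HF FB].
    rewrite (card_setD_natr R (proper_sub HF) (proper_sub FB)) mulrBl.
    by rewrite divff ?card_setD_neq0.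
  rewrite -(sum_above H w aH) mulr_suml -sumrB.
  apply: eq_bigr => F /btwP[FP HF FB].
  by rewrite (rel_splitB _ AH HB (proper_sub HF) (proper_sub FB)).
rewrite [X in _ + X](eq_bigr (fun F => w F * (s F - w F))); last first.
  move=> F cF; have [FP AF FB dF dB] := coP F cF.
  rewrite linearZ /= mcoeffZ; congr (_ * _).
  rewrite (q_deg0 _ _ _ dB) mulr1 dirD_q_deg1 // mcoeffC eqxx mulr1.
  rewrite /s -(sum_below F w cF).
  have FL := subset_trans (proper_sub FB) BL.
  (* The corrections below a coatom add up to exactly one copy of [w F]. *)
  have e1 : \sum_(H | btw P A F H) #|H :\: A|%:R / #|F :\: A|%:R = 1 :> R.
    by rewrite -mulr_suml pdeg1_sum_card // divff // card_setD_neq0.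
  rewrite -[X in _ - X]mul1r -e1 mulr_suml -sumrB.
  apply: eq_bigr => H /btwP[HP AH HF].
  by rewrite (rel_splitA _ AF FB (proper_sub AH) (proper_sub HF)).
have sq : \sum_(F | co F) s F ^+ 2 =
    (\sum_(H | at_ H) w H) ^+ 2 + \sum_(H | at_ H) (m H - 1) * w H ^+ 2.
  transitivity (\sum_(H | at_ H) \sum_(H' | at_ H')
      w H * w H' * \sum_(F | co F) N H F * N H' F).
    transitivity (\sum_(F | co F) \sum_(H | at_ H) \sum_(H' | at_ H')
      w H * w H' * (N H F * N H' F)).
      apply: eq_bigr => F _; rewrite expr2 /s mulr_suml; apply: eq_bigr => H _.
      by rewrite mulr_sumr; apply: eq_bigr => H' _; ring.
    rewrite exchange_big /=; apply: eq_bigr => H _.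
    rewrite exchange_big /=; apply: eq_bigr => H' _.
    by rewrite mulr_sumr.
  rewrite expr2 mulr_suml -big_split /=; apply: eq_bigr => H aH.
  rewrite mulr_sumr (bigD1 H) //= [X in _ = X + _](bigD1 H) //= common // eqxx mul1r.
  rewrite (eq_bigr (fun H' => w H * w H')); first ring.
  move=> H' /andP[aH' ne]; by rewrite common // eq_sym (negPf ne) mul0r addr0 mulr1.
have cross : \sum_(H | at_ H) w H * (\sum_(F | co F) N H F * w F) =
    \sum_(F | co F) w F * s F.
  transitivity (\sum_(H | at_ H) \sum_(F | co F) w H * (N H F * w F)).
    by apply: eq_bigr => H _; rewrite mulr_sumr.
  rewrite exchange_big /=; apply: eq_bigr => F _; rewrite /s mulr_sumr.
  by apply: eq_bigr => H _; ring.
rewrite (_ : _ + _ = - \sum_(F | co F) (w F - s F) ^+ 2).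
  by rewrite oppr_le0 sumr_ge0 // => F _; rewrite sqr_ge0.
have -> : \sum_(F | co F) (w F - s F) ^+ 2 = \sum_(F | co F) w F ^+ 2
   - 2 * (\sum_(F | co F) w F * s F) + \sum_(F | co F) s F ^+ 2.
  rewrite mulr_sumr -sumrB -big_split /=; apply: eq_bigr => F _; ring.
rewrite sq w0 -cross.
have -> : \sum_(F | co F) w F * (s F - w F) =
    \sum_(F | co F) w F * s F - \sum_(F | co F) w F ^+ 2.
  by rewrite -sumrB; apply: eq_bigr => F _; ring.
have -> : \sum_(H | at_ H) w H * (\sum_(F | co F) N H F * w F - (m H - 1) * w H)
    = \sum_(H | at_ H) w H * (\sum_(F | co F) N H F * w F)
      - \sum_(H | at_ H) (m H - 1) * w H ^+ 2.
  by rewrite -sumrB; apply: eq_bigr => H _; ring.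
rewrite -cross; ring.
Qed.

Lemma dirD_pch_deg1 x A s : A \in P -> chain P L A s -> cdeg P A s = 1%N ->
  exists c, dirD x (pch A s) = c%:MP.
Proof.
move=> AP cs d1; exists (\sum_(G | compat P A s G) wt A s x G).
rewrite (dirD_pch gradedP) // (raddf_sum (@mpolyC _ R)) /=.
apply: eq_bigr => G cG; rewrite pch_deg0 ?alg_mpolyC //.
by apply: succn_inj; rewrite -(cdeg_ins gradedP AP cs cG).
Qed.

(** Either one gap carries the whole degree, or the product is that of two linear forms and the form
    vanishes on the kernel of the first. *)
Lemma pch_deg2_hyperbolic A s : A \in P -> K \subset A -> chain P L A s ->
  cdeg P A s = 2%N -> hyperbolic [::] (pch A s).
Proof.
elim: s A => //= B s IH A AP KA /and4P[BP AB BL cB].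
have KB := subset_trans KA (proper_sub AB).
case dAB: (pdeg P A B) => [|[|[|n]]] //.
- by rewrite add0n => ds; rewrite q_deg0 // mul1r; exact: IH.
- move=> [ds]; exists (pch A [:: B]) => x.
  have cA : chain P L A [:: B] by rewrite /= BP AB BL.
  have [|c Dc] := dirD_pch_deg1 x AP cA; first by rewrite /= dAB.
  have [c' Dc'] := dirD_pch_deg1 x BP cB ds.
  rewrite Dc mcoeffC eqxx mulr1 => c0; move: Dc; rewrite c0 mpolyC0 /= mulr1 => Dq.
  by rewrite /ev /= !dirDM !Dq Dc' !mul0r !add0r dirDM Dq dirDC mul0r mulr0 addr0 mcoeff0.
- move=> [ds]; rewrite pch_deg0 ?mulr1; first exact: q_deg2_hyperbolic.
  by move: ds; case: (cdeg P B s).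
Qed.

(** The induction removes a direction and quantifies over all chains above [A], since each
    derivative refines the chain. *)
Lemma pch_hyperbolic vs A s : (forall v, v \in vs -> submod_cone v) ->
  A \in P -> K \subset A -> chain P L A s -> cdeg P A s = (size vs).+2 ->
  hyperbolic vs (pch A s).
Proof.
move=> + AP KA; elim: vs s => [|b vs IH] s Cvs cs deg.
  exact: pch_deg2_hyperbolic.
apply: hyperbolic_bochner => // G cG; apply: IH.
- by move=> v vvs; apply: Cvs; rewrite inE vvs orbT.
- exact: chain_ins.
- by apply: succn_inj; rewrite -(cdeg_ins gradedP AP cs cG) deg.
Qed.

End RankThree.

(** * From hyperbolic forms to the Lorentzian property *)

Lemma hyperbolic_form_mx (R : rcfType) (I : finType) (vs : seq {ffun I -> R})
    (p : {mpoly R[#|I|]}) (v : {ffun I -> R}) : hyperbolic vs p ->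
  0 < ev vs (dirD v (dirD v p)) ->
  one_pos_eigenvalue
    (form_mx (fun x y => (dirD x (dirD y (dirDs vs p)))@_0%MM)).
Proof.
move=> [g hg] v_gt0; set A := form_mx _.
pose e (k : 'I_#|I|) := unitv R (enum_val k).
have AE k l : A k l = ev vs (dirD (e k) (dirD (e l) p)).
  by rewrite mxE /ev !dirDs_dirD.
pose X (c : 'I_#|I| -> R) := [ffun i => \sum_k c k * e k i].
have qA c : qform A c = ev vs (dirD (X c) (dirD (X c) p)).
  rewrite [dirD (X c) (dirD _ _)]dirD_sum_dir (linear_sum (ev vs)) /=.
  apply: eq_bigr => k _; rewrite linearZ /= dirD_sum_dir dirD_sum.
  rewrite (linear_sum (ev vs)) /=; congr (_ * _); apply: eq_bigr => l _.
  by rewrite !linearZ /= AE mulrC.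
apply: (@hyperbolic_one_pos_eigenvalue _ _ _ (fun k => (dirD (e k) g)@_0%MM)).
- by apply/matrixP => k l; rewrite mxE !AE dirD_comm.
- move=> c c0; rewrite qA; apply: hg; rewrite dirD_sum_dir -[RHS]c0.
  rewrite (raddf_sum (mcoeff _)) /=; apply: eq_bigr => k _.
  by rewrite mcoeffZ mulrC.
- exists (fun k => v (enum_val k)); rewrite qA.
  suff -> : X (fun k => v (enum_val k)) = v by [].
  apply/ffunP => i; rewrite ffunE (bigD1 (enum_rank i)) //= /e enum_rankK.
  rewrite [unitv R i i]ffunE eqxx mulr1 big1 ?addr0 // => k ki; rewrite ffunE.
  rewrite (_ : (i == _) = false) ?mulr0 //.
  by apply: contraNF ki => /eqP ->; rewrite enum_valK.
Qed.

Theorem theorem3p7 (R : realType) (E : finType) (P : {set {set E}})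
    (K L : {set E})
    (gradedP : forall A B : {set E}, A \in P -> B \in P -> A \subset B ->
       graded (set_itv P A B))
    (KP : K \in P) (LP : L \in P) (KL : K \proper L)
    (flatsKL : lattice_of_flats L (set_itv P K L)) :
  lorentzian (@submod_cone E R K L) (pdeg P K L) (pol R P K L).
Proof.
have cKL : chain P L K [:: L] by rewrite /= LP KL subxx.
have dE : cdeg P K [:: L] = pdeg P K L by rewrite /= addn0.
have pE : pch R P K L K [:: L] = pol R P K L by rewrite /= mulr1 q_id.
split; first by rewrite -pE -dE; exact: pch_homog.
right=> vs Cvs; rewrite -pE; split.
  have szE : size vs = cdeg P K [:: L] by rewrite size_tuple.
  exact: (pch_ev_gt0 gradedP flatsKL Cvs KP (subxx K) cKL szE).
move=> d2; case: vs Cvs => [[|v [|v' vs]] /= szvs] Cvs.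
- by rewrite -(eqP szvs) in d2.
- by rewrite -(eqP szvs) in d2.
have Cv : submod_cone v by apply: Cvs; rewrite mem_head.
have Cvs' u : u \in vs -> submod_cone u.
  by move=> uvs; apply: Cvs; rewrite !inE uvs !orbT.
have szE : cdeg P K [:: L] = (size vs).+2 by rewrite dE -(eqP szvs).
(* Repeating [v] provides the vector at which the form is positive. *)
have Cvs2 u : u \in [:: v, v & vs] -> submod_cone u.
  by rewrite !inE => /orP[/eqP->|/orP[/eqP->|/Cvs']].
rewrite drop0; apply: (@hyperbolic_form_mx _ _ _ _ v).
  exact: (pch_hyperbolic gradedP flatsKL Cvs' KP (subxx K) cKL szE).
rewrite -!ev_cons.
exact: (pch_ev_gt0 gradedP flatsKL Cvs2 KP (subxx K) cKL (esym szE)).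
Qed.
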